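(* Let $1\le k\le\min\{m,n-1\}$. A symmetric $m$-tensor field $f\in\mathcal{S}(S^m)$ on $\mathbb{R}^n$ is in the kernel of the operator $\mathcal{I}^k$ if and only if $f=\mathrm{d}^{k+1}v$ for some symmetric $(m-k-1)$-tensor field $v\in C^\infty(S^{m-k-1})$ satisfying $\mathrm{d}^{\ell}v(x)\to 0$ as $|x|\to\infty$ for $\ell=0,1,\dots,k$.
   Context: $\mathcal{S}(S^m)$ and $C^\infty(S^m)$ denote the symmetric $m$-tensor fields on $\mathbb{R}^n$ whose components are Schwartz functions, respectively smooth functions. The inner differentiation (symmetrized derivative) $\mathrm{d}:C^\infty(S^p)\to C^\infty(S^{p+1})$ is $(\mathrm{d}u)_{i_1\dots i_{p+1}}=\sigma(i_1\dots i_{p+1})\left(\frac{\partial u_{i_1\dots i_p}}{\partial x_{i_{p+1}}}\right)$, where $\sigma(i_1\dots i_{p+1})$ averages over all permutations of the indices; $\mathrm{d}^\ell$ is its $\ell$-fold iterate ($\mathrm{d}^0$ the identity). Convention: when $k=m$ the only ''$(-1)$-tensor field'' is $0$, so the condition $f=\mathrm{d}^{k+1}v$ then means $f=0$. Let $T\mathbb{S}^{n-1}=\{(x,\xi)\in\mathbb{R}^n\times\mathbb{R}^n : |\xi|=1,\ \langle x,\xi\rangle=0\}$. For an integer $q\ge0$, the $q$-th integral moment transform of $f\in\mathcal{S}(S^m)$ is $$(I^q f)(x,\xi)=\int_{-\infty}^{\infty}t^q f_{i_1\dots i_m}(x+t\xi)\,\xi^{i_1}\cdots\xi^{i_m}\,dt,\qquad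 (x,\xi)\in T\mathbb{S}^{n-1}$$ (summation over repeated indices), and $\mathcal{I}^k f=(I^0f,I^1f,\dots,I^kf)$. *)

(* Defs.v *)
From HB Require Import structures.
From mathcomp Require Import all_boot all_order all_algebra all_fingroup.
From mathcomp Require Import all_classical all_reals all_analysis.

Set Implicit Arguments.
Unset Strict Implicit.
Unset Printing Implicit Defensive.

Import Order.TTheory GRing.Theory Num.Theory.
Import numFieldNormedType.Exports.

Local Open Scope classical_set_scope.
Local Open Scope ring_scope.

Section euclidean.
Context {R : realType} {n : nat}.
Implicit Types x y : 'rV[R]_n.

(* The library norm on ['rV[R]_n] is the maximum norm, hence an explicit
   Euclidean one. *)
Definition dotr x y : R := \sum_(i < n) x 0 i * y 0 i.

Definition enorm x : R := Num.sqrt (dotr x x).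

(* The filter "|x| --> oo" on R^n. *)
Definition at_infty : set_system 'rV[R]_n :=
  filter_from [set: R] (fun M => [set x | M < enorm x]).

Definition tangent_sphere : set ('rV[R]_n * 'rV[R]_n) :=
  [set p | enorm p.2 = 1 /\ dotr p.1 p.2 = 0].

End euclidean.

Section smooth_functions.
Context {R : realType} {n : nat}.
Implicit Types f : 'rV[R]_n -> R.

Definition pderiv (j : 'I_n) f : 'rV[R]_n -> R :=
  fun x => 'D_(delta_mx 0 j) f x.

Definition pderivs (s : seq 'I_n) f : 'rV[R]_n -> R := foldr pderiv f s.

(* ['D_v f x] is a total operator, so the existence of the partial derivatives
   of every order is required separately. *)
Definition smooth f : Prop :=
  forall s : seq 'I_n,
    (forall (j : 'I_n) x, derivable (pderivs s f) x (delta_mx 0 j)) /\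
    continuous (pderivs s f).

Definition schwartz f : Prop :=
  smooth f /\
  forall (a : 'I_n -> nat) (s : seq 'I_n), exists C : R,
    forall x : 'rV[R]_n, `|(\prod_(j < n) x 0 j ^+ a j) * pderivs s f x| <= C.

End smooth_functions.

(* [u i x] is the component u_{i_1 ... i_m}(x). *)
Definition tensor_field (R : realType) (n m : nat) : Type :=
  {ffun 'I_m -> 'I_n} -> 'rV[R]_n -> R.

Section tensor_fields.
Context {R : realType} {n : nat}.

Definition symmetric_field m (u : tensor_field R n m) : Prop :=
  forall (s : 'S_m) (i : {ffun 'I_m -> 'I_n}), u [ffun j => i (s j)] = u i.

Definition smooth_sym m (u : tensor_field R n m) : Prop :=
  symmetric_field u /\ forall i, smooth (u i).

Definition schwartz_sym m (u : tensor_field R n m) : Prop :=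
  symmetric_field u /\ forall i, schwartz (u i).

Definition inner_diff p (u : tensor_field R n p) : tensor_field R n p.+1 :=
  fun i x => (p.+1`!)%:R^-1 * \sum_(s : 'S_p.+1)
    pderiv (i (s ord_max)) (u [ffun j : 'I_p => i (s (widen_ord (leqnSn p) j))])
      x.

Fixpoint inner_diff_iter l p (u : tensor_field R n p) :
    tensor_field R n (l + p)%N :=
  match l return tensor_field R n (l + p)%N with
  | 0%N => u
  | l'.+1 => inner_diff (@inner_diff_iter l' p u)
  end.

Definition cast_field m m' (e : m = m') (u : tensor_field R n m) :
    tensor_field R n m' :=
  fun i => u [ffun j => i (cast_ord e j)].

Definition vanishes_at_infty m (u : tensor_field R n m) : Prop :=
  forall i, u i x @[x --> at_infty] --> (0 : R).

Definition moment_transform (q m : nat) (f : tensor_field R n m)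
    (x xi : 'rV[R]_n) : R :=
  (\int[lebesgue_measure]_(t in [set: R])
     (t ^+ q * (\sum_(i : {ffun 'I_m -> 'I_n})
                  (f i (x + t *: xi) * \prod_(j < m) xi 0 (i j)))))%R.

Definition in_moment_kernel (k m : nat) (f : tensor_field R n m) : Prop :=
  forall q : nat, (q <= k)%N -> forall p, tangent_sphere p ->
    moment_transform q f p.1 p.2 = 0.

End tensor_fields.

Arguments inner_diff_iter {R n} l {p} u.

(* Main.v *)
(* A field annihilated by the moments of order at most [k + 1] on all lines is
   annihilated by the ray transform, hence equal to [d v] with [v] rapidly
   decreasing; integrating by parts, the moments of order at most [k] of [v]
   vanish on all lines.  So everything reduces to [k = 0], by induction.

   For [k = 0], let [V xi x] be minus the integral of [f . xi^m] over the half-line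
   [x + t xi], [t >= 0].  It solves [<xi, grad> V = f . xi^m], and it is a Schwartz
   function of [x] because the integrals over the whole lines vanish.  The claim
   is that [V] is a polynomial in [xi].  On a plane [x + a xi + b e_j], the Fourier
   transform of [V (xi + s e_j)] at the frequency [(y1, y2)] is, up to a factor
   [i], the quotient by [y1 + s y2] of a polynomial of degree at most [m] in [s]
   that vanishes at [s = - y1 / y2]; it is thus a polynomial of degree less than
   [m].  By injectivity of the Fourier transform, so is [V (xi + s e_j) x].  The
   homogeneity of [V] in [xi] then makes it a form of degree [m - 1], whose
   polarization is the field [v]. *)

Require Import Defs.
From mathcomp Require Import all_boot all_order all_algebra all_fingroup.
From mathcomp Require Import all_classical all_reals all_analysis.
From mathcomp Require Import measurable_realfun ring lra.

Set Implicit Arguments.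
Unset Strict Implicit.
Unset Printing Implicit Defensive.

Import Order.TTheory GRing.Theory Num.Theory.
Import numFieldNormedType.Exports.

Local Open Scope classical_set_scope.
Local Open Scope ring_scope.

(** * Integrals of functions dominated by a Lorentzian *)

Section tame.
Context {R : realType}.
Notation mu := (@lebesgue_measure R).
Implicit Types (g h F : R -> R) (t : R).

(** Nothing is differentiated in [xi]: that a function of [s] is a polynomial of degree less than
    [m] is tested on the finite combinations of point values that annihilate such polynomials. These
    combinations commute with the integrals in [x]. The Fourier transforms are real cosine and sine
    integrals of functions bounded by Lorentzians, so dominated convergence and Fubini always use
    the same majorants. A plane through [xi] requires two axes, which [1 <= k <= n - 1] supplies.
    Two cases escape the argument and are settled by homogeneity: [xi] parallel to [e_j], where the
    plane degenerates, and [xi = 0]. For the converse, [v] is only smooth, with [d^l v] tending to 0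
    for [l <= k]. On a line of direction [xi], the contractions of the fields [d^l v] with [xi] are
    successive derivatives of one function, and the one for [l = k + 1] decreases rapidly because it
    comes from [f]. Integration from infinity carries rapid decrease down to [l = 0], and the
    moments of [f] then vanish by parts. *)

Definition lorentz t : R := (1 + t ^+ 2)^-1.

(** The bound survives sums, bounded factors and affine changes of variable, so the integrals on
    lines below converge for one and the same reason. *)
Definition tame g : Prop :=
  continuous g /\ exists C, forall t, `|g t| <= C * lorentz t.

Lemma lorentz_gt0 t : 0 < lorentz t.
Proof. by rewrite invr_gt0; have := sqr_ge0 t; lra. Qed.

Lemma lorentz_ge0 t : 0 <= lorentz t.
Proof. exact/ltW/lorentz_gt0. Qed.

Lemma lorentz_le1 t : lorentz t <= 1.
Proof. by rewrite invf_le1; have := sqr_ge0 t; lra. Qed.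

Lemma continuous_lorentz : continuous lorentz.
Proof. exact: continuous_oneDsqrV. Qed.

Lemma integrable_lorentz : mu.-integrable setT (EFin \o lorentz).
Proof.
apply/integrableP; split.
  by apply/measurable_EFinP; apply: continuous_measurable_fun; exact: continuous_lorentz.
rewrite (_ : (fun x => _) = (fun x => (lorentz x)%:E)); last first.
  by apply/funext => x /=; rewrite ger0_norm ?lorentz_ge0.
rewrite ge0_symfun_integralT.
- by rewrite -set_itvcy integral0y_oneDsqr -EFinM ltry.
- exact: lorentz_ge0.
- exact: continuous_lorentz.
- by move=> x /=; rewrite /lorentz sqrrN.
Qed.

Lemma tame_integrable g (D : set R) : measurable D -> tame g ->
  mu.-integrable D (EFin \o g).
Proof.
move=> mD [cg [C gC]]; apply: (integrableS measurableT) => //.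
apply: (@le_integrable _ _ _ mu _ _ _ (EFin \o (fun t => C * lorentz t))) => //.
- by apply/measurable_EFinP; apply: measurable_funTS; exact: continuous_measurable_fun.
- by move=> t _ /=; rewrite lee_fin (le_trans (gC t))// ler_norm.
- have := integrableZl measurableT C integrable_lorentz.
  by apply: eq_integrable => // t _ /=; rewrite EFinM.
Qed.

Lemma tame_lorentz : tame lorentz.
Proof.
split; first exact: continuous_lorentz.
by exists 1 => t; rewrite mul1r ger0_norm ?lorentz_ge0.
Qed.

Lemma tame_cst_mul c g : tame g -> tame (fun t => c * g t).
Proof.
move=> [cg [C gC]]; split; first by move=> t; apply: cvgM; [exact: cvg_cst|exact: cg].
by exists (`|c| * C) => t; rewrite normrM -mulrA ler_wpM2l.
Qed.

Lemma tameD g h : tame g -> tame h -> tame (fun t => g t + h t).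
Proof.
move=> [cg [C gC]] [ch [D hD]]; split; first by move=> t; apply: cvgD;
  [exact: cg|exact: ch].
by exists (C + D) => t; rewrite mulrDl (le_trans (ler_normD _ _))// lerD.
Qed.

Lemma tame0 : tame (fun=> 0 : R).
Proof.
by split; [move=> t; exact: cvg_cst|exists 0 => t; rewrite normr0 mul0r].
Qed.

Lemma tame_sum (I : Type) (r : seq I) (g : I -> R -> R) :
  (forall i, tame (g i)) -> tame (fun t => \sum_(i <- r) g i t).
Proof.
move=> tg; elim: r => [|i r IH].
  by under eq_fun do rewrite big_nil; exact: tame0.
by under eq_fun do rewrite big_cons; exact: tameD.
Qed.

Lemma tame_mul_bounded g h C : tame g -> continuous h ->
  (forall t, `|h t| <= C) -> tame (fun t => g t * h t).
Proof.
move=> [cg [D gD]] ch hC; split; first by move=> t; apply: cvgM; [exact: cg|exact: ch].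
exists (D * C) => t; rewrite normrM mulrAC ler_pM//; exact: gD.
Qed.

Definition Iline g : R := \int[mu]_(t in [set: R]) g t.

Definition Ihalf g : R := \int[mu]_(t in `[0, +oo[) g t.

Lemma IlineZ c g : tame g -> Iline (fun t => c * g t) = c * Iline g.
Proof. by move=> tg; rewrite /Iline RintegralZl//; exact: tame_integrable. Qed.

Lemma IlineD g h : tame g -> tame h ->
  Iline (fun t => g t + h t) = Iline g + Iline h.
Proof. by move=> tg th; rewrite /Iline RintegralD//; exact: tame_integrable. Qed.

Lemma Iline_sum (I : Type) (r : seq I) (g : I -> R -> R) :
  (forall i, tame (g i)) ->
  Iline (fun t => \sum_(i <- r) g i t) = \sum_(i <- r) Iline (g i).
Proof.
move=> tg; elim: r => [|i r IH].
  under eq_fun do rewrite big_nil; rewrite big_nil.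
  by rewrite /Iline Rintegral_cst// mul0r.
under eq_fun do rewrite big_cons.
by rewrite IlineD// ?big_cons ?IH//; exact: tame_sum.
Qed.

Lemma IhalfZ c g : tame g -> Ihalf (fun t => c * g t) = c * Ihalf g.
Proof. by move=> tg; rewrite /Ihalf RintegralZl//; exact: tame_integrable. Qed.

Lemma IhalfD g h : tame g -> tame h ->
  Ihalf (fun t => g t + h t) = Ihalf g + Ihalf h.
Proof. by move=> tg th; rewrite /Ihalf RintegralD//; exact: tame_integrable. Qed.

Lemma Ihalf_sum (I : Type) (r : seq I) (g : I -> R -> R) :
  (forall i, tame (g i)) ->
  Ihalf (fun t => \sum_(i <- r) g i t) = \sum_(i <- r) Ihalf (g i).
Proof.
move=> tg; elim: r => [|i r IH].
  under eq_fun do rewrite big_nil; rewrite big_nil.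
  by rewrite /Ihalf Rintegral_cst// mul0r.
under eq_fun do rewrite big_cons.
by rewrite IhalfD// ?big_cons ?IH//; exact: tame_sum.
Qed.

Lemma normr_Ihalf g C : tame g -> (forall t, 0 <= t -> `|g t| <= C * lorentz t) ->
  `|Ihalf g| <= C * (pi / 2).
Proof.
move=> tg gC; have tC := tame_cst_mul C tame_lorentz.
apply: (le_trans (le_normr_Rintegral _ _)) => //; first exact: tame_integrable.
apply: (@le_trans _ _ (Ihalf (fun t => C * lorentz t))).
  apply: le_Rintegral => //.
  - have := @tame_integrable g `[0, +oo[ (measurable_itv _) tg.
    by move/integrable_norm.
  - exact: tame_integrable.
  - by move=> t /=; rewrite in_itv/= andbT; exact: gC.
rewrite IhalfZ; last exact: tame_lorentz.
by rewrite /Ihalf /Rintegral integral0y_oneDsqr.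
Qed.

(* Adding a multiple of the Lorentzian makes a tame function nonnegative,
   which is what the improper FTC of the library requires. *)
Lemma Ihalf_FTC g F l : tame g -> continuous F ->
  (forall t, 0 < t -> is_derive t (1 : R) F (g t)) ->
  F t @[t --> +oo] --> l -> Ihalf g = l - F 0.
Proof.
move=> [cg [C gC]] cF dF Fl.
have tg : tame g by split => //; exists C.
have tw := tame_cst_mul C tame_lorentz.
have C0 : 0 <= C by have := gC 0; have := normr_ge0 (g 0); have := @lorentz_gt0 0; nra.
have dS (x : R) : 0 < x ->
    is_derive x (1 : R) (fun t => F t + C * atan t) (g x + C * lorentz x).
  move=> x0; have dFx := dF _ x0.
  exact: (is_deriveD dFx (is_deriveZ C (is_derive1_atan x))).
have E : Ihalf (fun t => g t + C * lorentz t) =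
    l + C * (pi / 2) - (F 0 + C * atan 0).
  apply: (@Rintegral_ge0_continuous_FTC2y _ _ (fun t => F t + C * atan t)).
  - by move=> x _; have := gC x; rewrite ler_norml; lra.
  - apply: continuous_subspaceT => x.
    apply: cvgD; first exact: cg.
    by apply: cvgM; [exact: cvg_cst|exact: continuous_lorentz].
  - by apply: cvgD => //; apply: cvgM; [exact: cvg_cst|exact: cvgy_atan].
  - by move=> x x0; exact: (@ex_derive _ _ _ _ _ _ _ (dS _ x0)).
  - apply: cvgD; first exact/cvg_at_right_filter/cF.
    apply: cvgM; [exact: cvg_cst|apply/cvg_at_right_filter; exact: continuous_atan].
  - move=> x; rewrite in_itv/= andbT => x0.
    by rewrite derive1E; exact: (@derive_val _ _ _ _ _ _ _ (dS _ x0)).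
rewrite IhalfD// IhalfZ in E; last exact: tame_lorentz.
have W : Ihalf lorentz = pi / 2 by rewrite /Ihalf /Rintegral integral0y_oneDsqr.
by move: E; rewrite W atan0; lra.
Qed.

End tame.

(** * Reflections and affine changes of variable *)

Section tame_subst.
Context {R : realType}.
Notation mu := (@lebesgue_measure R).
Implicit Types (g h F : R -> R) (t : R).

Lemma lorentz_affine (a b : R) : a != 0 ->
  exists2 K, 0 <= K & forall t, lorentz (a * t + b) <= K * lorentz t.
Proof.
move=> a0; have a2 : 0 < a ^+ 2 by rewrite exprn_even_gt0.
(* With [u = a t + b], [t = (u - b) / a] and [(u - b)^2 <= 2 u^2 + 2 b^2 <= 2 (1 + b^2) (1 +
   u^2)]. *)
exists (1 + 2 * (1 + b ^+ 2) / a ^+ 2).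
  by rewrite addr_ge0// divr_ge0 ?(ltW a2)//; have := sqr_ge0 b; lra.
move=> t; rewrite /lorentz; set u := a * t + b.
have E : t ^+ 2 = (u - b) ^+ 2 / a ^+ 2 by rewrite /u addrK exprMn mulrC mulKf ?gt_eqF.
have u2 := sqr_ge0 u; have t2 := sqr_ge0 t; have b2 := sqr_ge0 b.
have [p1 p2] : 0 < 1 + u ^+ 2 /\ 0 < 1 + t ^+ 2 by split; lra.
rewrite ler_pdivlMr// mulrC ler_pdivrMr// E.
have -> : (1 + 2 * (1 + b ^+ 2) / a ^+ 2) * (1 + u ^+ 2) =
  1 + u ^+ 2 + 2 * (1 + b ^+ 2) * (1 + u ^+ 2) / a ^+ 2 by field.
clearbody u; rewrite -[leRHS]addrA lerD2l;
  apply: (@le_trans _ _ (2 * (1 + b ^+ 2) * (1 + u ^+ 2) / a ^+ 2)).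
  rewrite ler_pM2r ?invr_gt0//; have := sqr_ge0 (u + b).
  have : 0 <= b ^+ 2 * u ^+ 2 by exact: mulr_ge0.
  have -> : (u + b) ^+ 2 = 2 * u ^+ 2 + 2 * b ^+ 2 - (u - b) ^+ 2 by ring.
  have -> : 2 * (1 + b ^+ 2) * (1 + u ^+ 2) =
    2 + 2 * u ^+ 2 + 2 * b ^+ 2 + 2 * (b ^+ 2 * u ^+ 2) by ring.
  by lra.
by rewrite lerDr.
Qed.

Lemma tame_affine (a b : R) g : a != 0 -> tame g -> tame (fun t => g (a * t + b)).
Proof.
move=> a0 [cg [C gC]]; have [K K0 aK] := lorentz_affine b a0.
have C0 : 0 <= C.
  have := gC 0; have := normr_ge0 (g 0).
  by have := @lorentz_gt0 R 0 => c0 n0 n1; rewrite -(pmulr_lge0 _ c0) (le_trans n0).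
split.
  move=> t; apply: (@continuous_comp _ _ _ (fun t => a * t + b) g); last exact: cg.
  by apply: cvgD; [apply: cvgM; [exact: cvg_cst|exact: cvg_id]|exact: cvg_cst].
by exists (C * K) => t; rewrite (le_trans (gC _))// -mulrA ler_wpM2l.
Qed.

Lemma tameN g : tame g -> tame (fun t => g (- t)).
Proof.
move=> /(@tame_affine (-1) 0 _ _); rewrite oppr_eq0 oner_eq0 => /(_ isT).
by under eq_fun do rewrite mulN1r addr0.
Qed.

(** Splitting at the origin and substitution are first proved for nonnegative functions. Applying
    them to [g + C * lorentz] and to [lorentz], then subtracting, extends them to tame functions. *)
Lemma tame_ge0_decomp g : tame g ->
  exists2 C, tame (fun t => g t + C * lorentz t) & forall t, 0 <= g t + C * lorentz t.
Proof.
move=> tg; have [_ [C gC]] := tg.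
exists C; last by move=> t; have := gC t; rewrite ler_norml; lra.
by apply: tameD => //; apply: tame_cst_mul; exact: tame_lorentz.
Qed.

Let integral_fin g (D : set R) : measurable D -> tame g ->
  (\int[mu]_(t in D) (g t)%:E)%E \is a fin_num.
Proof. by move=> mD tg; apply: integrable_fin_num => //; exact: tame_integrable. Qed.

Let Iline_half_ge0 g : tame g -> (forall t, 0 <= g t) ->
  Iline g = Ihalf g + Ihalf (fun t => g (- t)).
Proof.
move=> tg g0; have [cg _] := tg.
have mf : measurable_fun [set: R] g by exact: continuous_measurable_fun.
rewrite /Iline /Ihalf /Rintegral -fineD ?integral_fin//; last exact: tameN.
congr fine.
have mp : measurable [set x : R | 0 <= x]%R by rewrite -set_itvcy.
rewrite -(setUv [set x : R | 0 <= x]%R) ge0_integral_setU//=.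
- rewrite -set_itvcy// setCitvr; congr (_ + _)%E.
  rewrite integral_itv_bndo_bndc; last exact/measurable_EFinP/measurable_funTS.
  rewrite -{1}oppr0 ge0_integration_by_substitutionNy//.
  exact: continuous_subspaceT.
- exact: measurableC.
- by apply/measurable_EFinP; rewrite setUv.
- by move=> x _; rewrite lee_fin.
- exact/disj_setPCl.
Qed.

Lemma Iline_half g : tame g -> Iline g = Ihalf g + Ihalf (fun t => g (- t)).
Proof.
move=> tg; have [C tgC gC0] := tame_ge0_decomp tg.
have tc := @tame_lorentz R; have tC := tame_cst_mul C tc.
have := Iline_half_ge0 tgC gC0; have := Iline_half_ge0 tc (@lorentz_ge0 R).
have -> : (fun t => lorentz (- t)) = lorentz :> (R -> R).
  by apply/funext => t; rewrite /lorentz sqrrN.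
rewrite IlineD// IlineZ// IhalfD// IhalfZ//.
have -> : (fun t => g (- t) + C * lorentz (- t)) = (fun t => g (- t) + C * lorentz t).
  by apply/funext => t; rewrite /lorentz sqrrN.
rewrite IhalfD// ?IhalfZ//; last exact: tameN.
by move=> ->; rewrite mulrDr; lra.
Qed.

Lemma IlineN g : tame g -> Iline (fun t => g (- t)) = Iline g.
Proof.
move=> tg; rewrite !Iline_half//; last exact: tameN.
by under [in X in _ + X = _]eq_fun do rewrite opprK; rewrite addrC.
Qed.

Lemma Iline_FTC g F l1 l2 : tame g -> (forall t, is_derive t (1 : R) F (g t)) ->
  F t @[t --> +oo] --> l1 -> F t @[t --> -oo] --> l2 -> Iline g = l1 - l2.
Proof.
move=> tg dF F1 F2.
have cF : continuous F.
  move=> t; apply/differentiable_continuous/derivable1_diffP.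
  exact: (@ex_derive _ _ _ _ _ _ _ (dF t)).
have E1 : Ihalf g = l1 - F 0 by exact: Ihalf_FTC.
have E2 : Ihalf (fun t => g (- t)) = - l2 - - F (- 0).
  apply: (@Ihalf_FTC _ (fun t => g (- t)) (fun t => - F (- t))).
  - exact: tameN.
  - move=> t; apply: cvgN.
    by apply: (@continuous_comp _ _ _ -%R F); [exact: opp_continuous|exact: cF].
  - move=> t _; have D1 := dF (- t).
    have := is_deriveN (@is_derive1_comp _ F -%R t _ _ D1 (is_deriveNid t 1)).
    by move=> H; apply: is_derive_eq H _; rewrite mulrN1 opprK.
  - by apply: cvgN; apply/cvgNy_compNP.
by rewrite Iline_half// E1 E2 oppr0; lra.
Qed.

Let Iline_affine_ge0 (a b : R) g : 0 < a -> tame g -> (forall t, 0 <= g t) ->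
  Iline (fun t => g (a * t + b)) * a = Iline g.
Proof.
move=> a0 tg g0; have [cg _] := tg; set F := fun t => a * t + b.
have dF t : is_derive t (1 : R) F a.
  have := is_deriveD (is_deriveZ a (is_derive_id t 1)) (is_derive_cst b t 1).
  by move=> H; apply: is_derive_eq H _; rewrite addr0 /GRing.scale/= mulr1.
have F' : derive1 F = cst a.
  by apply/funext => t; rewrite derive1E; exact: (@derive_val _ _ _ _ _ _ _ (dF t)).
have ta := @tame_affine a b g (lt0r_neq0 a0) tg.
rewrite mulrC -IlineZ// /Iline /Rintegral; congr fine.
rewrite [RHS](@increasing_ge0_integration_by_substitutionT _ F)//.
- by apply: eq_integral => t _ /=; rewrite F' /= mulrC.
- by move=> x y xy; rewrite /F ltrD2r ltr_pM2l.
- by rewrite F'; exact: cst_continuous.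
- by rewrite F'; exact: is_cvg_cst.
- by rewrite F'; exact: is_cvg_cst.
- apply/cvgrNyPle => A; near=> x; rewrite /F -lerBrDr -ler_pdivlMl//.
- apply/cvgryPge => A; near=> x; rewrite /F -lerBlDr -ler_pdivrMl//.
Unshelve. all: by end_near. Qed.

Let Iline_affine_pos (a b : R) g : 0 < a -> tame g ->
  Iline (fun t => g (a * t + b)) * a = Iline g.
Proof.
move=> a0 tg; have [C tgC gC0] := tame_ge0_decomp tg.
have tc := @tame_lorentz R; have tC := tame_cst_mul C tc.
have := Iline_affine_ge0 b a0 tgC gC0.
have := Iline_affine_ge0 b a0 tc (@lorentz_ge0 R).
have ta := @tame_affine a b g (lt0r_neq0 a0) tg.
have tca := @tame_affine a b _ (lt0r_neq0 a0) tc.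
rewrite !IlineD//; last exact: tame_cst_mul.
by rewrite !IlineZ// mulrDl -mulrA => ->; lra.
Qed.

Lemma Iline_affine (a b : R) g : a != 0 -> tame g ->
  Iline (fun t => g (a * t + b)) = `|a|^-1 * Iline g.
Proof.
move=> a0 tg; have ap : 0 < `|a| by rewrite normr_gt0.
apply: (mulIf (lt0r_neq0 ap)); rewrite mulrAC mulVf ?mul1r ?lt0r_neq0//.
have [ag|al] := ltP 0 a; first by rewrite gtr0_norm// Iline_affine_pos.
have {}al : a < 0 by rewrite lt_neqAle a0.
rewrite ltr0_norm// -[RHS](@Iline_affine_pos (- a) b g) ?oppr_gt0//.
rewrite -IlineN; last exact: tame_affine.
by under eq_fun do rewrite mulrN -mulNr.
Qed.

End tame_subst.

(** * Iterated integrals *)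

Lemma pair_cvg (T : Type) (U V : topologicalType) (F : set_system T) (FF : Filter F)
    (u : T -> U) (v : T -> V) (a : U) (b : V) :
  u x @[x --> F] --> a -> v x @[x --> F] --> b ->
  (u x, v x) @[x --> F] --> (a, b).
Proof.
move=> ua vb A [[B C] /= [nB nC] BC].
have uB : \forall x \near F, B (u x) by exact: ua.
have vC : \forall x \near F, C (v x) by exact: vb.
by near=> x; apply: BC; split => /=; near: x.
Unshelve. all: by end_near. Qed.

Section prod_measurable.
Context {R : realType}.

Let mesh (n : nat) (a : R) : R := (Num.floor (a * n.+1%:R))%:~R / n.+1%:R.

Let mesh_cvg (a : R) : mesh n a @[n --> \oo] --> a.
Proof.
apply/cvgrPdist_le => e e0; near=> n; rewrite /mesh.
have n0 : 0 < n.+1%:R :> R by rewrite ltr0n.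
have -> : a - (Num.floor (a * n.+1%:R))%:~R / n.+1%:R =
  (a * n.+1%:R - (Num.floor (a * n.+1%:R))%:~R) / n.+1%:R.
  by rewrite mulrBl mulfK ?gt_eqF.
have h1 := Num.Theory.floor_le (a * n.+1%:R).
have h2 := Num.Theory.floorD1_gt (a * n.+1%:R).
rewrite ger0_norm; last by rewrite divr_ge0 ?subr_ge0.
apply: (@le_trans _ _ (n.+1%:R^-1)).
  rewrite -[leRHS]mul1r ler_pM2r ?invr_gt0// lerBlDl.
  by move: h2; rewrite intrD => /ltW.
by near: n; apply: filterS (near_infty_natSinv_lt (PosNum e0)) => n; exact: ltW.
Unshelve. all: by end_near. Qed.

(** Measurability is for the product sigma-algebra. Rounding the first argument down to a multiple
    of [1 / (n + 1)] gives functions whose preimages are countable unions of rectangles; they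
    converge pointwise to [g]. *)
Lemma continuous_measurable2 (g : R * R -> R) : continuous g ->
  measurable_fun [set: measurableTypeR R * measurableTypeR R] g.
Proof.
move=> cg; apply: (@measurable_fun_cvg _ _ _ _ (fun n x => g (mesh n x.1, x.2))).
  move=> n _ A mA; rewrite setTI.
  have -> : (fun x : R * R => g (mesh n x.1, x.2)) @^-1` A =
     \bigcup_(k : int) ([set a : R | Num.floor (a * n.+1%:R) = k] `*`
        ((fun b : R => g (k%:~R / n.+1%:R, b)) @^-1` A)).
    apply/seteqP; split => -[a b] /=.
      by move=> gA; exists (Num.floor (a * n.+1%:R)).
    by move=> [k _ /= [<-]].
  apply: countable_bigcupT_measurable; first exact: countableP.
  move=> k; apply: measurableX.
    rewrite (_ : [set a : R | _] = `[k%:~R / n.+1%:R, (k + 1)%:~R / n.+1%:R[%classic)//.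
    have n0 : 0 < n.+1%:R :> R by rewrite ltr0n.
    apply/seteqP; split => a /=; rewrite in_itv/= ler_pdivrMr// ltr_pdivlMr//.
      move=> <-; rewrite Num.Theory.floor_le; exact: Num.Theory.floorD1_gt.
    by move=> /Num.Theory.floor_def.
  rewrite -[X in measurable X]setTI.
  apply: (@continuous_measurable_fun R (fun b : R => g (k%:~R / n.+1%:R, b))) => //.
  move=> b; apply: (@continuous_comp _ _ _ (fun b : R => (k%:~R / n.+1%:R : R, b)) g);
    last exact: cg.
  by apply: pair_cvg; [exact: cvg_cst|exact: cvg_id].
move=> [a b] _ /=.
apply: (@cvg_comp _ _ _ (fun n => (mesh n a, b)) g _ (nbhs (a, b))); last exact: cg.
by apply: pair_cvg; [exact: mesh_cvg|exact: cvg_cst].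
Qed.

End prod_measurable.

(** * Functions on the plane dominated by a product of Lorentzians *)

Section tame2.
Context {R : realType}.
Notation mu := (@lebesgue_measure R).
Implicit Types (g : R -> R -> R).

Definition tame2 g : Prop :=
  continuous (fun p : R * R => g p.1 p.2) /\
  exists C, forall a b, `|g a b| <= C * lorentz a * lorentz b.

Lemma tame2_bound g : tame2 g ->
  exists2 C, 0 <= C & forall a b, `|g a b| <= C * lorentz a * lorentz b.
Proof.
move=> [_ [C gC]]; exists `|C| => // a b; rewrite (le_trans (gC a b))//.
by rewrite -!mulrA ler_wpM2r ?ler_norm// mulr_ge0 ?lorentz_ge0.
Qed.

Lemma continuous_row g a : continuous (fun p : R * R => g p.1 p.2) ->
  continuous (g a).
Proof.
move=> cg b; apply: (@continuous_comp _ _ _ (fun b : R => (a, b)) (fun p => g p.1 p.2)).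
  by apply: pair_cvg; [exact: cvg_cst|exact: cvg_id].
exact: cg.
Qed.

Lemma continuous_swap_args g : continuous (fun p : R * R => g p.1 p.2) ->
  continuous (fun p : R * R => g p.2 p.1).
Proof.
move=> cg p.
apply: (@continuous_comp _ _ _ (fun p : R * R => (p.2, p.1)) (fun p => g p.1 p.2)).
  by apply: pair_cvg; [exact: cvg_snd|exact: cvg_fst].
exact: cg.
Qed.

Lemma tame2_swap g : tame2 g -> tame2 (fun b a => g a b).
Proof.
move=> [cg [C gC]]; split; first exact: continuous_swap_args.
by exists C => a b; rewrite mulrAC.
Qed.

Lemma tame2_row g a : tame2 g -> tame (g a).
Proof.
by move=> [cg [C gC]]; split; [exact: continuous_row|exists (C * lorentz a)].
Qed.

Lemma tame2_col g b : tame2 g -> tame (g^~ b).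
Proof. by move=> /tame2_swap /tame2_row. Qed.

Lemma normr_Iline (h : R -> R) C : tame h -> (forall t, `|h t| <= C * lorentz t) ->
  `|Iline h| <= C * pi.
Proof.
move=> th hC; rewrite Iline_half// (le_trans (ler_normD _ _))//.
have -> : C * pi = C * (pi / 2) + C * (pi / 2) by field.
rewrite lerD//; apply: normr_Ihalf => //; first exact: tameN.
by move=> t _; rewrite (le_trans (hC _))// /lorentz sqrrN.
Qed.

Lemma tame2_int g : tame2 g -> tame (fun a => Iline (g a)).
Proof.
move=> tg; have [C C0 gC] := tame2_bound tg; have [cg _] := tg.
split; last first.
  exists (C * pi) => a; rewrite mulrAC; apply: normr_Iline; first exact: tame2_row.
  exact: gC.
(* A majorant independent of [a], as [lorentz a <= 1]. *)
move=> a; pose h := fun b => C * lorentz b.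
have th : tame h by apply: tame_cst_mul; exact: tame_lorentz.
apply: (@continuity_under_integral R _ _ mu g setT measurableT (a - 1) (a + 1) _ _ h).
- by move=> x _; apply: tame_integrable => //; exact: tame2_row.
- apply: aeW => b _ x _.
  exact: (@continuous_row (fun b a => g a b) b (continuous_swap_args cg)).
- exact: tame_integrable.
- move=> x _; apply: aeW => b _; rewrite (le_trans (gC _ _))// /h.
  by rewrite ler_wpM2r ?lorentz_ge0// ler_piMr// lorentz_le1.
- by rewrite inE/= in_itv/=; apply/andP; split; lra.
Qed.

Lemma Iline_swap g : tame2 g ->
  Iline (fun a => Iline (g a)) = Iline (fun b => Iline (g^~ b)).
Proof.
move=> tg; have [C C0 gC] := tame2_bound tg; have [cg _] := tg.
have tg' := tame2_swap tg.
have E (h : R -> R -> R) : tame2 h -> (\int[mu]_a \int[mu]_b (h a b)%:E)%E =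
    (Iline (fun a => Iline (h a)))%:E.
  move=> thh; rewrite {1}/Iline /Rintegral fineK; last first.
    by apply: integrable_fin_num => //; apply: tame_integrable => //; exact: tame2_int.
  apply: eq_integral => a _; rewrite /Iline /Rintegral fineK//.
  by apply: integrable_fin_num => //; apply: tame_integrable => //; exact: tame2_row.
suff : (Iline (fun a => Iline (g a)))%:E = (Iline (fun b => Iline (g^~ b)))%:E.
  by move=> -[].
rewrite -!E//.
have mg := continuous_measurable2 cg.
have := @Fubini _ _ _ _ R mu mu (fun p : R * R => (g p.1 p.2)%:E); apply.
(* Integrability on the product reduces to finiteness of the iterated integral of the absolute
   value, which is again [tame2]. *)
apply/integrable12ltyP; first exact/measurable_EFinP.
have tn : tame2 (fun a b => `|g a b|).
  split; last by exists C => a b; rewrite normr_id.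
  by move=> p; apply: cvg_norm; exact: cg.
rewrite [X in (X < _)%E](_ : _ = (Iline (fun a => Iline (fun b => `|g a b|)))%:E).
  exact: ltry.
exact: E tn.
Qed.

End tame2.

(** * Injectivity of the Fourier transform *)

Section fourier.
Context {R : realType}.
Notation mu := (@lebesgue_measure R).
Implicit Types (u : R -> R) (g : R -> R -> R).

(** From [e^r >= 1 + r^2 / 2 >= (1 + r^2) / 2] for [r >= 0]. *)
Lemma expRN_norm_le (s : R) : expR (- `|s|) <= 2 * lorentz s.
Proof.
rewrite expRN; have := @expR_ge1Dxn R `|s| 1 (normr_ge0 s).
rewrite -normrX ger0_norm ?sqr_ge0// => h.
rewrite -[leRHS]invrK lef_pV2 ?posrE ?expR_gt0//; last first.
  by rewrite invr_gt0 mulr_gt0// lorentz_gt0.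
rewrite invfM /lorentz invrK mulrDr mulr1.
apply: le_trans h; rewrite mulrC lerD2r.
by rewrite invf_le1 ?ler1n.
Qed.

Lemma continuous_expRN_norm : continuous (fun s : R => expR (- `|s|)).
Proof.
move=> s; apply: (@continuous_comp R R R (fun s => - `|s|) (@expR R));
  last exact: continuous_expR.
by apply: cvgN; exact: norm_continuous.
Qed.

Lemma tame_expRN_norm : tame (fun s : R => expR (- `|s|)).
Proof.
split; first exact: continuous_expRN_norm.
by exists 2 => s; rewrite ger0_norm ?expR_ge0// expRN_norm_le.
Qed.

Lemma continuous_mulr_cos (v : R) : continuous (fun s : R => cos (s * v)).
Proof.
move=> s; apply: (@continuous_comp R R R (fun s => s * v) (@cos R));
  last exact: continuous_cos.
by apply: cvgM; [exact: cvg_id|exact: cvg_cst].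
Qed.

Lemma continuous_mulr_sin (v : R) : continuous (fun s : R => sin (s * v)).
Proof.
move=> s; apply: (@continuous_comp R R R (fun s => s * v) (@sin R));
  last exact: continuous_sin.
by apply: cvgM; [exact: cvg_id|exact: cvg_cst].
Qed.

Lemma Ihalf_expRN_cos (v : R) :
  Ihalf (fun s => expR (- `|s|) * cos (s * v)) = lorentz v.
Proof.
have d0 : 1 + v ^+ 2 != 0 by apply: lt0r_neq0; have := sqr_ge0 v; lra.
(* The antiderivative of [e^(- s) cos (s v)] given by two integrations by parts, with
   [F 0 = - 1 / (1 + v^2)]. Its derivative is the integrand in [|s|] only for [s >= 0], which
   suffices on the half-line. *)
pose F (s : R) := expR (- s) * (v * sin (s * v) - cos (s * v)) / (1 + v ^+ 2).
have dF (s : R) : is_derive s (1 : R) F (expR (- s) * cos (s * v)).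
  have dv : is_derive s (1 : R) (fun s : R => s * v) v.
    have := is_deriveM (is_derive_id s (1 : R)) (is_derive_cst v s (1 : R)).
    by move=> H; apply: is_derive_eq H _; rewrite /= /GRing.scale/= mulr0 add0r mulr1.
  have ds := @is_derive1_comp _ sin _ s _ _ (is_derive_sin (s * v)) dv.
  have dc := @is_derive1_comp _ cos _ s _ _ (is_derive_cos (s * v)) dv.
  have de := @is_derive1_comp _ expR _ s _ _ (is_derive_expR (- s)) (is_deriveNid s (1
    : R)).
  have := is_deriveM (is_deriveM de (is_deriveB (is_deriveZ v ds) dc))
     (is_derive_cst (1 + v ^+ 2)^-1 s (1 : R)).
  move=> H; apply: is_derive_eq H _.
  rewrite /= /GRing.scale/= !fctE /=.
  have -> : (v *: sin (s * v) : R) = v * sin (s * v) by [].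
  by field.
have -> : lorentz v = 0 - F 0.
  by rewrite /F oppr0 expR0 mul0r sin0 cos0 mulr0 mul1r sub0r /lorentz sub0r mulN1r opprK.
apply: (@Ihalf_FTC _ _ F 0).
- by apply: tame_mul_bounded tame_expRN_norm _ _; [exact: continuous_mulr_cos|move=> t;
  exact: cos_max].
- move=> s; apply/differentiable_continuous/derivable1_diffP.
  exact: (@ex_derive _ _ _ _ _ _ _ (dF s)).
- by move=> s s0; have := dF s; rewrite ger0_norm// ltW.
- apply/cvgr0Pnorm_le => e e0; near=> s; rewrite /F !normrM.
  have s0 : 0 <= s by near: s; apply: nbhs_pinfty_ge; exact: num_real.
  rewrite (ger0_norm (expR_ge0 _)) [X in _ * X <= _]ger0_norm;
    last by rewrite invr_ge0 addr_ge0// sqr_ge0.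
  apply: (@le_trans _ _ (expR (- s) * (`|v| + 1))).
    rewrite -mulrA ler_wpM2l ?expR_ge0// -[leRHS]mulr1 ler_pM ?invr_ge0 ?addr_ge0
      ?sqr_ge0//.
    - rewrite (le_trans (ler_normB _ _))// lerD ?cos_max// normrM -[leRHS]mulr1.
      by rewrite ler_wpM2l// sin_max.
    - by rewrite invf_le1 ?lerDl ?sqr_ge0// ltr_pwDl// sqr_ge0.
  have v1 : 0 < `|v| + 1 by rewrite ltr_wpDl.
  rewrite -ler_pdivlMr// expRN -[leRHS]invrK lef_pV2 ?posrE ?expR_gt0 ?invr_gt0 ?divr_gt0//.
  apply: le_trans (expR_ge1Dx s); apply: (@le_trans _ _ s); last by rewrite lerDr.
  by near: s; apply: nbhs_pinfty_ge; exact: num_real.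
Unshelve. all: by end_near. Qed.

(** The Fourier transform of [e^(- |s|)] is twice the Lorentzian, the Poisson kernel whose dilations
    form the approximate identity of the inversion argument. *)
Lemma Iline_expRN_cos (v : R) :
  Iline (fun s => expR (- `|s|) * cos (s * v)) = 2 * lorentz v.
Proof.
rewrite Iline_half; last first.
  by apply: tame_mul_bounded tame_expRN_norm _ _; [exact: continuous_mulr_cos|move=> t;
    exact: cos_max].
have -> : (fun s : R => expR (- `|- s|) * cos (- s * v)) =
    (fun s => expR (- `|s|) * cos (s * v)).
  by apply/funext => s; rewrite normrN mulNr cosN.
by rewrite Ihalf_expRN_cos; lra.
Qed.

(** Finite exceptional sets arise because division by [y1 + s * y2] fails at the frequencies where
    this factor vanishes. *)
Lemma Iline_ae0 (h : R -> R) (B : seq R) : tame h ->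
  (forall t, t \notin B -> h t = 0) -> Iline h = 0.
Proof.
move=> [ch _] h0; have mh := continuous_measurable_fun ch.
rewrite /Iline /Rintegral (@ae_eq_integral _ _ _ mu setT (cst 0%E))//.
- by rewrite integral0.
- exact/measurable_EFinP.
- exists [set` B]; split.
  + apply: countable_measurable; last exact: (finite_set_countable (finite_seq B)).
    by move=> t; exact: measurable_set1.
  + by apply: countable_lebesgue_measure0; exact: (finite_set_countable (finite_seq B)).
  + move=> t /= H; apply: contrapT => tB; apply: H => _.
    by rewrite h0//; apply/negP.
Qed.

Lemma Iline_lorentz : Iline (@lorentz R) = pi.
Proof.
rewrite Iline_half; last exact: tame_lorentz.
have -> : (fun t => lorentz (- t)) = @lorentz R.
  by apply/funext => t; rewrite /lorentz sqrrN.
have -> : Ihalf (@lorentz R) = pi / 2 by rewrite /Ihalf /Rintegral integral0y_oneDsqr.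
by field.
Qed.

(* Pairing the vanishing Fourier transform with [expR (- `|s|)] gives
   [\int u(t0 + A v) / (1 + v^2) dv = 0] for all [A > 0]; then let [A] tend to
   [0]. *)
Lemma fourier_inj u (B : seq R) : tame u ->
  (forall s, s \notin B -> Iline (fun t => u t * cos (t * s)) = 0 /\
                          Iline (fun t => u t * sin (t * s)) = 0) ->
  forall t, u t = 0.
Proof.
move=> tu uB t0; have [cu [C0 uC0]] := tu.
have [C C_ge0 uC] : exists2 C, 0 <= C & forall t, `|u t| <= C.
  exists `|C0| => // t; rewrite (le_trans (uC0 t))// (le_trans (ler_norm _))//.
  by rewrite normrM ler_piMr// ger0_norm ?lorentz_ge0// lorentz_le1.
have tcos (h : R -> R) (s : R) : tame h -> tame (fun t => h t * cos (t * s)).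
  by move=> th; apply: (@tame_mul_bounded _ h (fun t => cos (t * s)) 1) => //;
    [exact: continuous_mulr_cos|move=> t; exact: cos_max].
have tsin (h : R -> R) (s : R) : tame h -> tame (fun t => h t * sin (t * s)).
  by move=> th; apply: (@tame_mul_bounded _ h (fun t => sin (t * s)) 1) => //;
    [exact: continuous_mulr_sin|move=> t; exact: sin_max].
have pos (A : R) : 0 < A -> Iline (fun v => u (A * v + t0) * lorentz v) = 0.
  move=> A0; have An0 := lt0r_neq0 A0.
  have tuA := @tame_affine R A t0 u An0 tu.
  have zero (s : R) : s / A \notin B -> Iline (fun v => u (A * v + t0) * cos (s * v)) = 0.
    move=> sB; have [Hc Hs] := uB _ sB.
    (* [phi t = u t * cos ((t - t0) * (s / A))]: the translation by [t0] mixes the cosine and sine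
       transforms of [u], both zero at [s / A]. *)
    pose phi (t : R) := cos (t0 * (s / A)) * (u t * cos (t * (s / A))) +
                  sin (t0 * (s / A)) * (u t * sin (t * (s / A))).
    have tp1 := tame_cst_mul (cos (t0 * (s / A))) (tcos _ (s / A) tu).
    have tp2 := tame_cst_mul (sin (t0 * (s / A))) (tsin _ (s / A) tu).
    have tphi : tame phi by exact: tameD.
    have -> : (fun v => u (A * v + t0) * cos (s * v)) = (fun v => phi (A * v + t0)).
      apply/funext => v; have -> : s * v = (A * v + t0) * (s / A) - t0 * (s / A) by field.
      by rewrite cosB /phi; ring.
    rewrite Iline_affine// IlineD//.
    by rewrite !IlineZ ?Hc ?Hs ?mulr0 ?addr0 ?mulr0//; do ?[exact: tcos | exact: tsin].
  pose g (s v : R) := expR (- `|s|) * (u (A * v + t0) * cos (s * v)).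
  have tg : tame2 g.
    split.
      move=> p; apply: cvgM.
        apply: (@continuous_comp (R * R)%type R R fst (fun s => expR (- `|s|))).
          exact: cvg_fst.
        exact: continuous_expRN_norm.
      apply: cvgM.
        apply: (@continuous_comp (R * R)%type R R snd (fun v => u (A * v + t0))).
          exact: cvg_snd.
        by case: tuA => + _; apply.
      apply: (@continuous_comp (R * R)%type R R (fun p => p.1 * p.2) (@cos R)).
        by apply: cvgM; [exact: cvg_fst|exact: cvg_snd].
      exact: continuous_cos.
    have [_ [D uD]] := tuA.
    exists (2 * D) => s' v; rewrite /g !normrM (ger0_norm (expR_ge0 _)).
    have -> : 2 * D * lorentz s' * lorentz v = 2 * lorentz s' * (D * lorentz v) by ring.
    apply: ler_pM; rewrite ?expR_ge0 ?expRN_norm_le ?mulr_ge0//.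
    by rewrite -[leRHS]mulr1; apply: ler_pM; rewrite ?cos_max.
  (* Integrating in [v] first gives 0 for all but finitely many [s]; integrating in [s] first turns
     the exponential and cosine factors into [2 * lorentz v]. *)
  have := Iline_swap tg.
  rewrite (@Iline_ae0 _ [seq A * s | s <- B]); last 2 first.
  - exact: tame2_int.
  - move=> s sB; rewrite /g IlineZ; last first.
      by under eq_fun do rewrite mulrC [X in cos X]mulrC -[_ * u _]mulrC; exact: tcos.
    rewrite zero ?mulr0//; apply: contra sB => sB; apply/mapP; exists (s / A) => //.
    by rewrite mulrC mulfVK.
  have -> : (fun b => Iline (g^~ b)) = (fun v => 2 * (u (A * v + t0) * lorentz v)).
    apply/funext => v; rewrite /g; under eq_fun do rewrite mulrCA.
    rewrite IlineZ ?Iline_expRN_cos; first by rewrite mulrCA.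
    exact/tcos/tame_expRN_norm.
  rewrite IlineZ; last first.
    by under eq_fun do rewrite mulrC; apply: tame_mul_bounded (@tame_lorentz R) _ _;
      [case: tuA|move=> t; exact: uC].
  by move=> /esym/eqP; rewrite mulf_eq0 pnatr_eq0/= => /eqP.
pose f (A v : R) := u (A * v + t0) * lorentz v.
pose h := fun v : R => C * lorentz v.
have tf A : tame (f A).
  rewrite /f; under eq_fun do rewrite mulrC.
  apply: tame_mul_bounded (@tame_lorentz R) _ _; last by move=> t; exact: uC.
  move=> v; apply: (@continuous_comp R R R (fun v => A * v + t0) u); last exact: cu.
  by apply: cvgD; [apply: cvgM; [exact: cvg_cst|exact: cvg_id]|exact: cvg_cst].
have cH : {for 0, continuous (fun A => Iline (f A))}.
  apply: (@continuity_under_integral R _ _ mu f setT measurableT (-1) 1 _ _ h).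
  - by move=> x _; exact: tame_integrable.
  - apply: aeW => v _ A _; apply: cvgM; last exact: cvg_cst.
    apply: (@continuous_comp R R R (fun A => A * v + t0) u); last exact: cu.
    by apply: cvgD; [apply: cvgM; [exact: cvg_id|exact: cvg_cst]|exact: cvg_cst].
  - by apply: tame_integrable => //; apply: tame_cst_mul; exact: tame_lorentz.
  - move=> A _; apply: aeW => v _; rewrite /f /h normrM (ger0_norm (lorentz_ge0 _)).
    by rewrite ler_wpM2r ?lorentz_ge0.
  - by rewrite inE/= in_itv/=; apply/andP; split; lra.
have H0 : Iline (f 0) = 0.
  have l1 : Iline (f A) @[A --> 0^'+] --> Iline (f 0) by exact: cvg_at_right_filter.
  have l2 : Iline (f A) @[A --> 0^'+] --> (0 : R).
    apply: cvg_near_cst; near=> A.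
    by apply: pos; near: A; exact: nbhs_right_gt.
  by rewrite -(cvg_lim (@Rhausdorff R) l1) (cvg_lim (@Rhausdorff R) l2).
move: H0; rewrite /f; under eq_fun do rewrite mul0r add0r.
rewrite IlineZ ?Iline_lorentz; last exact: tame_lorentz.
by move=> /eqP; rewrite mulf_eq0 (gt_eqF (pi_gt0 R)) orbF => /eqP.
Unshelve. all: by end_near. Qed.

(** * Cosine and sine transforms on the plane *)

Definition Iplane g : R := Iline (fun a => Iline (g a)).

Lemma tame2_cst_mul (c : R) g : tame2 g -> tame2 (fun a b => c * g a b).
Proof.
move=> [cg [C gC]]; split; first by move=> t; apply: cvgM; [exact: cvg_cst|exact: cg].
by exists (`|c| * C) => a b; rewrite normrM -!mulrA ler_wpM2l// mulrA.
Qed.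

Lemma tame2D g h : tame2 g -> tame2 h -> tame2 (fun a b => g a b + h a b).
Proof.
move=> [cg [C gC]] [ch [D hD]]; split.
  by move=> t; apply: cvgD; [exact: cg|exact: ch].
by exists (C + D) => a b; rewrite !mulrDl (le_trans (ler_normD _ _))// lerD.
Qed.

Lemma tame2_0 : tame2 (fun _ _ => 0 : R).
Proof.
by split; [move=> t; exact: cvg_cst|exists 0 => a b; rewrite normr0 !mul0r].
Qed.

Lemma tame2_sum (I : Type) (r : seq I) (g : I -> R -> R -> R) :
  (forall i, tame2 (g i)) -> tame2 (fun a b => \sum_(i <- r) g i a b).
Proof.
move=> tg; elim: r => [|i r IH].
  rewrite (_ : (fun _ _ => _) = (fun _ _ => 0)); first exact: tame2_0.
  by apply/funext => a; apply/funext => b; rewrite big_nil.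
rewrite (_ : (fun _ _ => _) = (fun a b => g i a b + \sum_(i <- r) g i a b)).
  exact: tame2D.
by apply/funext => a; apply/funext => b; rewrite big_cons.
Qed.

Lemma tame2_mul_bounded g h C : tame2 g ->
  continuous (fun p : R * R => h p.1 p.2) -> (forall a b, `|h a b| <= C) ->
  tame2 (fun a b => g a b * h a b).
Proof.
move=> [cg [D gD]] ch hC; split.
  by move=> t; apply: cvgM; [exact: cg|exact: ch].
exists (D * C) => a b.
have -> : D * C * lorentz a * lorentz b = D * lorentz a * lorentz b * C by ring.
by rewrite normrM; apply: ler_pM.
Qed.

Lemma IplaneZ (c : R) g : tame2 g -> Iplane (fun a b => c * g a b) = c * Iplane g.
Proof.
move=> tg; rewrite /Iplane -IlineZ; last exact: tame2_int.
by congr Iline; apply/funext => a; rewrite IlineZ//; exact: tame2_row.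
Qed.

Lemma Iplane_sum (I : Type) (r : seq I) (g : I -> R -> R -> R) :
  (forall i, tame2 (g i)) ->
  Iplane (fun a b => \sum_(i <- r) g i a b) = \sum_(i <- r) Iplane (g i).
Proof.
move=> tg; rewrite /Iplane -Iline_sum; last by move=> i; exact: tame2_int.
by congr Iline; apply/funext => a; rewrite Iline_sum// => i; exact: tame2_row.
Qed.

Let continuous_phase (y1 y2 : R) :
  continuous (fun p : R * R => p.1 * y1 + p.2 * y2).
Proof.
by move=> p; apply: cvgD; apply: cvgM;
  [exact: cvg_fst|exact: cvg_cst|exact: cvg_snd|exact: cvg_cst].
Qed.

Lemma tame2_cos g (y1 y2 : R) : tame2 g ->
  tame2 (fun a b => g a b * cos (a * y1 + b * y2)).
Proof.
move=> tg; apply: (@tame2_mul_bounded g (fun a b => cos (a * y1 + b * y2)) 1) => //.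
  move=> p; apply: (@continuous_comp (R * R)%type R R (fun p => p.1 * y1 + p.2 * y2)
    (@cos R)).
    exact: continuous_phase.
  exact: continuous_cos.
by move=> a b; exact: cos_max.
Qed.

Lemma tame2_sin g (y1 y2 : R) : tame2 g ->
  tame2 (fun a b => g a b * sin (a * y1 + b * y2)).
Proof.
move=> tg; apply: (@tame2_mul_bounded g (fun a b => sin (a * y1 + b * y2)) 1) => //.
  move=> p; apply: (@continuous_comp (R * R)%type R R (fun p => p.1 * y1 + p.2 * y2)
    (@sin R)).
    exact: continuous_phase.
  exact: continuous_sin.
by move=> a b; exact: sin_max.
Qed.

Definition cos_transform g (y1 y2 : R) : R :=
  Iplane (fun a b => g a b * cos (a * y1 + b * y2)).

Definition sin_transform g (y1 y2 : R) : R :=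
  Iplane (fun a b => g a b * sin (a * y1 + b * y2)).

(** One-dimensional injectivity is used twice: for fixed [y2 != 0], in the variable [a], it kills
    the partial transforms [Cf y2] and [Sf y2]; then, in [b], it kills [g a0], with [0] as the only
    exceptional frequency. *)
Lemma fourier_inj2 g (B : R -> seq R) : tame2 g ->
  (forall y1 y2, y2 != 0 -> y1 \notin B y2 ->
     cos_transform g y1 y2 = 0 /\ sin_transform g y1 y2 = 0) ->
  forall a b, g a b = 0.
Proof.
move=> tg gB a0.
have tgc y2 : tame2 (fun a b => g a b * cos (b * y2)).
  have := tame2_cos 0 y2 tg.
  rewrite (_ : (fun a b => _) = (fun a b => g a b * cos (b * y2)))//.
  by apply/funext => a; apply/funext => b; rewrite mulr0 add0r.
have tgs y2 : tame2 (fun a b => g a b * sin (b * y2)).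
  have := tame2_sin 0 y2 tg.
  rewrite (_ : (fun a b => _) = (fun a b => g a b * sin (b * y2)))//.
  by apply/funext => a; apply/funext => b; rewrite mulr0 add0r.
pose Cf y2 a := Iline (fun b => g a b * cos (b * y2)).
pose Sf y2 a := Iline (fun b => g a b * sin (b * y2)).
have tC y2 : tame (Cf y2) by exact: tame2_int (tgc y2).
have tS y2 : tame (Sf y2) by exact: tame2_int (tgs y2).
have tcos (h : R -> R) (s : R) : tame h -> tame (fun t => h t * cos (t * s)).
  by move=> th; apply: (@tame_mul_bounded _ h (fun t => cos (t * s)) 1) => //;
    [exact: continuous_mulr_cos|move=> t; exact: cos_max].
have tsin (h : R -> R) (s : R) : tame h -> tame (fun t => h t * sin (t * s)).
  by move=> th; apply: (@tame_mul_bounded _ h (fun t => sin (t * s)) 1) => //;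
    [exact: continuous_mulr_sin|move=> t; exact: sin_max].
have EC y1 y2 : cos_transform g y1 y2 =
    Iline (fun a => Cf y2 a * cos (a * y1)) - Iline (fun a => Sf y2 a * sin (a * y1)).
  rewrite -[- Iline _]mulN1r -IlineZ; last exact: tsin.
  rewrite -IlineD; [|exact: tcos|by apply: tame_cst_mul; exact: tsin].
  congr Iline; apply/funext => a; rewrite /Cf /Sf mulN1r.
  rewrite [Iline _ * cos _]mulrC [Iline _ * sin _]mulrC -mulNr.
  have r1 := tame2_row a (tgc y2); have r2 := tame2_row a (tgs y2).
  rewrite -!IlineZ// -IlineD; try exact: tame_cst_mul.
  by congr Iline; apply/funext => b; rewrite cosD; ring.
have ES y1 y2 : sin_transform g y1 y2 =
    Iline (fun a => Cf y2 a * sin (a * y1)) + Iline (fun a => Sf y2 a * cos (a * y1)).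
  rewrite -IlineD; [|exact: tsin|exact: tcos].
  congr Iline; apply/funext => a; rewrite /Cf /Sf.
  rewrite [Iline _ * cos _]mulrC [Iline _ * sin _]mulrC.
  have r1 := tame2_row a (tgc y2); have r2 := tame2_row a (tgs y2).
  rewrite -!IlineZ// -IlineD; try exact: tame_cst_mul.
  by congr Iline; apply/funext => b; rewrite sinD; ring.
(* The values at [y1] and [- y1] together separate the four integrals by parity, hence the
   symmetrized exceptional set. *)
have key y1 y2 : y2 != 0 -> y1 \notin B y2 ++ [seq - y | y <- B y2] ->
    [/\ Iline (fun a => Cf y2 a * cos (a * y1)) = 0,
        Iline (fun a => Cf y2 a * sin (a * y1)) = 0,
        Iline (fun a => Sf y2 a * cos (a * y1)) = 0 &
        Iline (fun a => Sf y2 a * sin (a * y1)) = 0].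
  move=> y20; rewrite mem_cat negb_or => /andP[y1B y1N].
  have y1B' : - y1 \notin B y2.
    by apply: contra y1N => ?; apply/mapP; exists (- y1); rewrite ?opprK.
  have [] := gB _ _ y20 y1B; have [] := gB _ _ y20 y1B'.
  rewrite !EC !ES.
  have cN (h : R -> R) : Iline (fun a => h a * cos (a * - y1)) = Iline (fun a => h a *
    cos (a * y1)).
    by congr Iline; apply/funext => a; rewrite mulrN cosN.
  have sN (h : R -> R) : tame h ->
      Iline (fun a => h a * sin (a * - y1)) = - Iline (fun a => h a * sin (a * y1)).
    move=> th; rewrite -[RHS]mulN1r -IlineZ; last exact: tsin.
    by congr Iline; apply/funext => a; rewrite mulrN sinN; ring.
  by rewrite !cN !sN// => *; split; lra.
apply: (@fourier_inj (g a0) [:: 0]); first exact: tame2_row.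
move=> y2; rewrite inE => y20; split.
  apply: (@fourier_inj (Cf y2) _ (tC y2)) => s /(key _ _ y20)[? ? _ _].
  by split.
apply: (@fourier_inj (Sf y2) _ (tS y2)) => s /(key _ _ y20)[_ _ ? ?].
by split.
Qed.

Lemma tame_cvgy h : tame h -> h t @[t --> +oo] --> (0 : R).
Proof.
move=> [_ [C hC]]; apply/cvgr0Pnorm_le => e e0; near=> t.
rewrite (le_trans (hC t))// (le_trans (ler_norm _))// normrM.
rewrite (ger0_norm (lorentz_ge0 _)) /lorentz.
have t1 : 1 <= t by near: t; apply: nbhs_pinfty_ge; exact: num_real.
have t2 : `|C| / e <= t by near: t; apply: nbhs_pinfty_ge; exact: num_real.
rewrite ler_pdivrMr; last by have := sqr_ge0 t; lra.
rewrite mulrC -ler_pdivrMr// (le_trans t2)//.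
by have : t * 1 <= t * t by [rewrite ler_wpM2l//; lra]; rewrite mulr1 -expr2; lra.
Unshelve. all: by end_near. Qed.

Lemma tame_cvgNy h : tame h -> h t @[t --> -oo] --> (0 : R).
Proof. by move=> /tameN/tame_cvgy; move/cvgNy_compNP. Qed.

(* Integration by parts along the direction [(1, s)]. *)
Lemma transform_shear (P F : R -> R -> R) (s : R) :
  tame2 P -> tame2 F ->
  tame2 (fun a b => P a (b + s * a)) -> tame2 (fun a b => F a (b + s * a)) ->
  (forall a b, is_derive a (1 : R) (fun a => P a (b + s * a)) (F a (b + s * a))) ->
  forall y1 y2,
    cos_transform F y1 y2 = (y1 + s * y2) * sin_transform P y1 y2 /\
    sin_transform F y1 y2 = - (y1 + s * y2) * cos_transform P y1 y2.
Proof.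
move=> tP tF; set Ps := fun a b => P a (b + s * a); set Fs := fun a b => F a (b + s * a).
move=> tPs tFs dP y1 y2; set k := y1 + s * y2.
(* A translation of the inner variable. In the sheared coordinates the phase is
   [a * (y1 + s * y2) + b * y2], and the derivative along [(1, s)] is the one in [a]. *)
have shear (h : R -> R -> R) : tame2 h ->
    Iplane (fun a b => h a (b + s * a)) = Iplane h.
  move=> th; congr Iline; apply/funext => a.
  have := @Iline_affine R 1 (s * a) (h a) (oner_neq0 _) (tame2_row a th).
  by rewrite normr1 invr1 mul1r => <-; congr Iline; apply/funext => b; rewrite mul1r.
have phase a b : a * y1 + (b + s * a) * y2 = a * k + b * y2 by rewrite /k; ring.
have shc h : tame2 h -> cos_transform h y1 y2 = cos_transform (fun a b => h a (b + s *
  a)) k y2.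
  move=> th; rewrite /cos_transform -(shear _ (tame2_cos y1 y2 th)).
  by congr Iline; apply/funext => a; congr Iline; apply/funext => b; rewrite phase.
have shs h : tame2 h -> sin_transform h y1 y2 = sin_transform (fun a b => h a (b + s *
  a)) k y2.
  move=> th; rewrite /sin_transform -(shear _ (tame2_sin y1 y2 th)).
  by congr Iline; apply/funext => a; congr Iline; apply/funext => b; rewrite phase.
rewrite !shc// !shs//.
have dph a b : is_derive a (1 : R) (fun a => a * k + b * y2) k.
  have := is_deriveD (is_deriveM (is_derive_id a (1 : R)) (is_derive_cst k a (1 : R)))
    (is_derive_cst (b * y2) a (1 : R)).
  by move=> H; apply: is_derive_eq H _; rewrite /= /GRing.scale/= mulr0 add0r mulr1 addr0.
have parts (b : R) :
  Iline (fun a => Fs a b * cos (a * k + b * y2)) = k * Iline (fun a => Ps a b * sin (a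
    * k + b * y2)) /\
  Iline (fun a => Fs a b * sin (a * k + b * y2)) = - k * Iline (fun a => Ps a b * cos
    (a * k + b * y2)).
  have tFc := tame2_col b (tame2_cos k y2 tFs).
  have tFsn := tame2_col b (tame2_sin k y2 tFs).
  have tPc := tame2_col b (tame2_cos k y2 tPs).
  have tPsn := tame2_col b (tame2_sin k y2 tPs).
  have zc : Iline (fun a => Fs a b * cos (a * k + b * y2) + - k * (Ps a b * sin (a * k
    + b * y2))) = 0.
    rewrite -[RHS]subr0; apply: (@Iline_FTC _ _ (fun a => Ps a b * cos (a * k + b *
      y2)) 0 0).
    - by apply: tameD => //; exact: tame_cst_mul.
    - move=> a; have dc := @is_derive1_comp _ (@cos R) _ a _ _ (is_derive_cos (a * k +
      b * y2)) (dph a b).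
      have := is_deriveM (dP a b) dc.
      by move=> H; apply: is_derive_eq H _; rewrite /= /GRing.scale/= /Fs /Ps; ring.
    - exact: tame_cvgy.
    - exact: tame_cvgNy.
  have zs : Iline (fun a => Fs a b * sin (a * k + b * y2) + k * (Ps a b * cos (a * k +
    b * y2))) = 0.
    rewrite -[RHS]subr0; apply: (@Iline_FTC _ _ (fun a => Ps a b * sin (a * k + b *
      y2)) 0 0).
    - by apply: tameD => //; exact: tame_cst_mul.
    - move=> a; have dc := @is_derive1_comp _ (@sin R) _ a _ _ (is_derive_sin (a * k +
      b * y2)) (dph a b).
      have := is_deriveM (dP a b) dc.
      by move=> H; apply: is_derive_eq H _; rewrite /= /GRing.scale/= /Fs /Ps; ring.
    - exact: tame_cvgy.
    - exact: tame_cvgNy.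
  move: zc zs; rewrite !IlineD//; try exact: tame_cst_mul.
  by rewrite !IlineZ// => zc zs; split; lra.
rewrite /cos_transform /sin_transform /Iplane.
(* The integration by parts is in the outer variable [a], so the order of integration is
   exchanged. *)
rewrite (Iline_swap (tame2_cos k y2 tFs)) (Iline_swap (tame2_sin k y2 tFs)).
rewrite (Iline_swap (tame2_cos k y2 tPs)) (Iline_swap (tame2_sin k y2 tPs)).
split.
- rewrite -IlineZ; last exact: tame2_int (tame2_swap (tame2_sin k y2 tPs)).
  by congr Iline; apply/funext => b; case: (parts b).
- rewrite -IlineZ; last exact: tame2_int (tame2_swap (tame2_cos k y2 tPs)).
  by congr Iline; apply/funext => b; case: (parts b).
Qed.

End fourier.

(** * Smooth and Schwartz functions *)

Lemma is_deriveP (R : realType) (V : normedModType R) (f : V -> R) (x v : V) (d : R) :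
  is_derive x v f d <-> h^-1 *: (f (h *: v + x) - f x) @[h --> 0^'] --> d.
Proof.
split.
  by move=> [df <-]; exact: df.
move=> fd; have := fd => /cvg_lim; split; first by apply/cvg_ex; exists d.
exact: cvg_lim fd.
Qed.

(** * Directional derivatives *)

Section directional.
Context {R : realType} {V : normedModType R}.
Implicit Types (f : V -> R) (x v : V).

Lemma is_derive_line f x v (t d : R) :
  is_derive (x + t *: v) v f d <-> is_derive t (1 : R) (fun t => f (x + t *: v)) d.
Proof.
rewrite is_deriveP.
have -> : (fun h : R => h^-1 *: (f (h *: v + (x + t *: v)) - f (x + t *: v))) =
  (fun h : R => h^-1 *: (f (x + (h *: (1 : R) + t) *: v) - f (x + t *: v))).
  apply/funext => h; congr (_ *: (f _ - _)).
  by rewrite scalerDl -[in RHS]scalerA scale1r addrCA.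
exact: (iff_sym (is_deriveP (fun t : R => f (x + t *: v)) t 1 d)).
Qed.

Lemma is_derive_scale f x v (c d : R) :
  is_derive x v f d -> is_derive x (c *: v) f (c * d).
Proof.
move=> fd; have : is_derive (0 : R) (1 : R) (fun t => f (x + t *: (c *: v))) (c * d).
  have -> : (fun t => f (x + t *: (c *: v))) = (fun t => f (x + t *: v)) \o (fun t : R
    => t * c).
    by apply/funext => t /=; rewrite scalerA.
  have d1 : is_derive (0 : R) (1 : R) (fun t : R => t * c) c.
    have := is_deriveM (is_derive_id (0 : R) (1 : R)) (is_derive_cst c (0 : R) (1 : R)).
    by move=> H; apply: is_derive_eq H _; rewrite /= /GRing.scale/= mulr0 add0r mulr1.
  rewrite mulrC; apply: (@is_derive1_comp R (fun t => f (x + t *: v)) _ 0 d c) d1.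
  by apply/is_derive_line; rewrite mul0r scale0r addr0.
by move=> /is_derive_line; rewrite scale0r addr0.
Qed.

Lemma MVT0 (F F' : R -> R) (h : R) : (forall t, is_derive t (1 : R) F (F' t)) ->
  exists2 c, `|c| <= `|h| & F h - F 0 = F' c * h.
Proof.
move=> dF; have cF : continuous F.
  by move=> t; apply/differentiable_continuous/derivable1_diffP;
    exact: (@ex_derive _ _ _ _ _ _ _ (dF t)).
have [h0|h0] := leP 0 h.
  have [c] := @MVT_segment R F F' 0 h h0 (fun t _ => dF t) (continuous_subspaceT cF).
  rewrite in_itv/= subr0 => /andP[c0 ch] ->; exists c => //.
  by rewrite !ger0_norm.
have [c] := @MVT_segment R F F' h 0 (ltW h0) (fun t _ => dF t) (continuous_subspaceT cF).
rewrite in_itv/= sub0r => /andP[c0 ch] E; exists c.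
  by rewrite (ltr0_norm h0) ler0_norm// lerN2.
by move: E; rewrite mulrN; lra.
Qed.

(** The increment along [h (u + v)] is a step along [u] followed by a step along [v]. The mean value
    theorem on the second step leaves [df] at a point that tends to [x], where it is continuous;
    Frechet differentiability does not enter. *)
Lemma is_derive_addv f (df : V -> R) x u v (d : R) :
  is_derive x u f d -> (forall y, is_derive y v f (df y)) ->
  {for x, continuous df} -> is_derive x (u + v) f (d + df x).
Proof.
move=> /is_deriveP fu fv cdf; apply/is_deriveP.
have -> : (fun h : R => h^-1 *: (f (h *: (u + v) + x) - f x)) =
  (fun h : R => h^-1 *: (f (h *: u + x) - f x) +
      h^-1 *: (f ((h *: u + x) + h *: v) - f (h *: u + x))).
  apply/funext => h; rewrite -scalerDr; congr (_ *: _).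
  by rewrite scalerDr addrAC; ring.
apply: cvgD => //; apply/cvgrPdist_le => e e0.
have /nbhs_ballP[r /= r0 rP] : \forall y \near x, `|df x - df y| <= e.
  by move/cvgrPdist_le : cdf; exact.
pose K := `|u| + `|v| + 1.
have K0 : 0 < K by rewrite /K ltr_wpDl// addr_ge0.
near=> h.
have hn0 : h != 0 by near: h; exact: nbhs_dnbhs_neq.
have [c ch ->] : exists2 c, `|c| <= `|h| &
    f (h *: u + x + h *: v) - f (h *: u + x) = df (h *: u + x + c *: v) * h.
  have [c ch E] := MVT0 h (fun t => (is_derive_line f (h *: u + x) v t _).1 (fv _)).
  by exists c => //; rewrite -E scale0r addr0.
rewrite /GRing.scale/= mulrC mulfK//; apply: rP.
rewrite -ball_normE/=.
have -> : x - (h *: u + x + c *: v) = - (h *: u + c *: v).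
  by rewrite addrAC opprD addrCA subrr addr0.
rewrite normrN.
rewrite (le_lt_trans (ler_normD _ _))// !normrZ.
have hr : `|h| < r / K.
  near: h; apply: dnbhs0_lt; exact: divr_gt0.
apply: (@le_lt_trans _ _ (`|h| * (`|u| + `|v|))).
  by rewrite mulrDr lerD2l ler_wpM2r.
apply: (@le_lt_trans _ _ (`|h| * K)); first by rewrite ler_wpM2l// /K lerDl.
by rewrite -ltr_pdivlMr.
Unshelve. all: by end_near. Qed.

End directional.

Section smooth.
Context {R : realType} {n : nat}.
Implicit Types (f g : 'rV[R]_n -> R) (x y v : 'rV[R]_n).

Lemma smooth_is_derive f j x : smooth f ->
  is_derive x (delta_mx 0 j : 'rV[R]_n) f (pderiv j f x).
Proof. by move=> /(_ [::])[/(_ j x) df _]; exact: derivableP. Qed.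

Lemma smooth_continuous f : smooth f -> continuous f.
Proof. by move=> /(_ [::])[]. Qed.

Lemma pderivs_cat s1 s2 f : pderivs (s1 ++ s2) f = pderivs s1 (pderivs s2 f).
Proof. exact: foldr_cat. Qed.

Lemma smooth_pderivs s f : smooth f -> smooth (pderivs s f).
Proof. by move=> sf s'; rewrite -pderivs_cat; exact: sf. Qed.

Lemma smooth_pderiv j f : smooth f -> smooth (pderiv j f).
Proof. exact: (@smooth_pderivs [:: j]). Qed.

Definition dirderiv v f x : R := \sum_(j < n) v 0 j * pderiv j f x.

Lemma smooth_dirderiv f v x : smooth f -> is_derive x v f (dirderiv v f x).
Proof.
move=> sf; have : is_derive x (\sum_(j < n) v 0 j *: delta_mx 0 j : 'rV[R]_n) f
    (dirderiv v f x).
  rewrite /dirderiv; elim: (index_enum 'I_n) => [|j r IH].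
    rewrite !big_nil; exact: is_derive0.
  have dj y : is_derive y (v 0 j *: delta_mx 0 j : 'rV[R]_n) f (v 0 j * pderiv j f y).
    by apply: is_derive_scale; exact: smooth_is_derive.
  have cj : {for x, continuous (fun y => v 0 j * pderiv j f y)}.
    have cj : {for x, continuous (pderiv j f)} by exact: smooth_continuous
      (smooth_pderiv j sf) x.
    exact: (cvgM (cvg_cst (v 0 j)) cj).
  have := is_derive_addv IH dj cj.
  by rewrite !big_cons [X in is_derive _ X]addrC [X in is_derive _ _ _ X]addrC.
by rewrite -row_sum_delta.
Qed.

Lemma smooth_line f v x (t : R) : smooth f ->
  is_derive t (1 : R) (fun t => f (x + t *: v)) (dirderiv v f (x + t *: v)).
Proof.
move=> sf; exact: ((is_derive_line f x v t _).1 (smooth_dirderiv v _ sf)).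
Qed.

Lemma pderiv_eq f g j x : is_derive x (delta_mx 0 j : 'rV[R]_n) f (g x) -> pderiv j f x
  = g x.
Proof. by move=> H; exact: (@derive_val _ _ _ _ _ _ _ H). Qed.

(** A class of continuous functions whose partial derivatives stay in the class settles all orders
    of differentiation at once. Locating the derivatives in the class also carries decay estimates
    over to them. *)
Lemma smooth_closed (P : ('rV[R]_n -> R) -> Prop) :
  (forall f, P f -> continuous f) ->
  (forall f j, P f -> exists2 g, P g & forall x,
    is_derive x (delta_mx 0 j : 'rV[R]_n) f (g x)) ->
  forall f, P f -> smooth f /\ forall s, P (pderivs s f).
Proof.
move=> Pc Pd f Pf; have Ps s : P (pderivs s f).
  elim: s => [|j s IH] //=; have [g Pg dg] := Pd _ j IH.
  by have -> : pderiv j (pderivs s f) = g by apply/funext => x; exact: pderiv_eq.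
split => // s; split; last exact: Pc.
move=> j x; have [g _ /(_ x) dg] := Pd _ j (Ps s).
exact: (@ex_derive _ _ _ _ _ _ _ dg).
Qed.

Lemma pderivs_lin (I : Type) (r : seq I) (c : I -> R) (f : I -> 'rV[R]_n -> R) s :
  (forall i, smooth (f i)) ->
  pderivs s (fun x => \sum_(i <- r) c i * f i x) =
  (fun x => \sum_(i <- r) c i * pderivs s (f i) x).
Proof.
move=> sf; elim: s => [|j s IH] //=; rewrite IH; apply/funext => x.
apply: (@pderiv_eq _ (fun x => \sum_(i <- r) c i * pderiv j (pderivs s (f i)) x)).
have d i : is_derive x (delta_mx 0 j : 'rV[R]_n) (fun x => c i * pderivs s (f i) x)
    (c i * pderiv j (pderivs s (f i)) x).
  have := is_deriveM (is_derive_cst (c i) x _) (smooth_is_derive j x (smooth_pderivs s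
    (sf i))).
  by move=> H; apply: is_derive_eq H _; rewrite /= scaler0 addr0.
elim: r {IH} => [|i r IHr].
  rewrite big_nil; under eq_fun do rewrite big_nil; exact: is_derive_cst.
rewrite big_cons; under eq_fun do rewrite big_cons.
exact: (is_deriveD (d i) IHr).
Qed.

Lemma smooth_lin (I : Type) (r : seq I) (c : I -> R) (f : I -> 'rV[R]_n -> R) :
  (forall i, smooth (f i)) -> smooth (fun x => \sum_(i <- r) c i * f i x).
Proof.
move=> sf s; rewrite pderivs_lin//; split.
  move=> j x; have d i : derivable (fun x => c i * pderivs s (f i) x) x (delta_mx 0 j :
    'rV[R]_n).
    by apply: derivableM; [exact: derivable_cst|case: (sf i s)].
  elim: r => [|i r IHr].
    under eq_fun do rewrite big_nil; exact: derivable_cst.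
  by under eq_fun do rewrite big_cons; exact: derivableD.
have d i : continuous (fun x => c i * pderivs s (f i) x).
  by move=> x; exact: (cvgM (cvg_cst (c i)) ((sf i s).2 x)).
elim: r => [|i r IHr] x.
  rewrite (_ : (fun _ => _) = cst 0); first exact: cst_continuous.
  by apply/funext => y; rewrite big_nil.
rewrite (_ : (fun _ => _) = (fun y => c i * pderivs s (f i) y + \sum_(i <- r) c i *
  pderivs s (f i) y)).
  exact: (cvgD (d i x) (IHr x)).
by apply/funext => y; rewrite big_cons.
Qed.

End smooth.

(** * Polynomial weights and rapid decrease *)

Section schwartz.
Context {R : realType} {n : nat}.
Implicit Types (f g : 'rV[R]_n -> R) (x y v : 'rV[R]_n).

Lemma dotrDl x y v : dotr (x + y) v = dotr x v + dotr y v.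
Proof. by rewrite -big_split/=; apply: eq_bigr => i _; rewrite mxE mulrDl. Qed.

Lemma dotrC x y : dotr x y = dotr y x.
Proof. by apply: eq_bigr => i _; rewrite mulrC. Qed.

Lemma dotrZl (c : R) x y : dotr (c *: x) y = c * dotr x y.
Proof. by rewrite /dotr mulr_sumr; apply: eq_bigr => i _; rewrite mxE mulrA. Qed.

Lemma dotrNl x y : dotr (- x) y = - dotr x y.
Proof. by rewrite -scaleN1r dotrZl mulN1r. Qed.

Lemma dotr_sqr_ge0 x : 0 <= dotr x x.
Proof. by apply: sumr_ge0 => i _; rewrite -expr2 sqr_ge0. Qed.

Lemma dotr_sqrD x y : dotr (x + y) (x + y) = dotr x x + 2 * dotr x y + dotr y y.
Proof. by rewrite dotrDl ![dotr _ (x + y)]dotrC !dotrDl [dotr y x]dotrC; ring. Qed.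

Lemma dotr_coord x (j : 'I_n) : x 0 j ^+ 2 <= dotr x x.
Proof.
rewrite /dotr (bigD1 j)//= -expr2 lerDl; apply: sumr_ge0 => i _.
by rewrite -expr2 sqr_ge0.
Qed.

Lemma dotr_gt0 x : x != 0 -> 0 < dotr x x.
Proof.
move=> x0; rewrite lt_neqAle dotr_sqr_ge0 andbT eq_sym; apply: contra x0 => /eqP x0.
apply/eqP/rowP => j; rewrite mxE; apply/eqP; rewrite -sqrf_eq0 eq_le sqr_ge0 andbT.
by rewrite -x0 dotr_coord.
Qed.

(** The square of the usual weight [sqrt (1 + |x|^2)]: without the root, its powers expand into
    monomials. *)
Definition bracket x : R := 1 + dotr x x.

Lemma bracket_ge1 x : 1 <= bracket x.
Proof. by rewrite lerDl dotr_sqr_ge0. Qed.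

Lemma bracket_gt0 x : 0 < bracket x.
Proof. exact: lt_le_trans (bracket_ge1 x). Qed.

Lemma coord_le_bracket x (j : 'I_n) : `|x 0 j| <= bracket x.
Proof.
have := dotr_coord x j; rewrite /bracket -real_normK ?num_real//.
by have := sqr_ge0 (`|x 0 j| - 1); rewrite sqrrB1; have := normr_ge0 (x 0 j); nra.
Qed.

Definition rapid g : Prop :=
  forall N, exists C, forall x, bracket x ^+ N * `|g x| <= C.

Lemma rapid_bound g N : rapid g ->
  exists2 C, 0 <= C & forall x, `|g x| <= C / bracket x ^+ N.
Proof.
move=> /(_ N)[C gC]; have C0 : 0 <= C.
  by rewrite (le_trans _ (gC 0))// mulr_ge0// exprn_ge0// ltW// bracket_gt0.
by exists C => // x; rewrite ler_pdivlMr ?exprn_gt0 ?bracket_gt0// mulrC.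
Qed.

Lemma finite_bounds (I : finType) (T : Type) (F : I -> T -> R) :
  (forall i, exists C, forall t : T, F i t <= C) ->
  exists C, forall t : T, \sum_i F i t <= C.
Proof.
move=> /choice[C FC]; exists (\sum_i C i) => t.
by apply: ler_sum => i _; exact: FC.
Qed.

(** Each coordinate is at most [bracket x] in absolute value, so powers of the weight dominate
    monomials. Conversely, a factor [bracket x] is [1] plus the squares of the coordinates, so an
    induction on the power, for all monomials at once, raises one exponent by two at each step. *)
Lemma rapidP g : rapid g <-> forall a : 'I_n -> nat,
  exists C, forall x, `|(\prod_(j < n) x 0 j ^+ a j) * g x| <= C.
Proof.
split=> [rg a|mg N].
  have [C gC] := rg (\sum_(j < n) a j)%N; exists C => x.
  rewrite normrM (le_trans _ (gC x))// ler_wpM2r// normr_prod expr_sum.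
  apply: ler_prod => j _; rewrite normr_ge0 normrX lerXn2r ?nnegrE//.
    exact/ltW/bracket_gt0.
  exact: coord_le_bracket.
suff /(_ (fun=> 0%N))[C gC] : forall a : 'I_n -> nat, exists C, forall x,
    bracket x ^+ N * `|(\prod_(j < n) x 0 j ^+ a j) * g x| <= C.
  by exists C => x; have := gC x; rewrite big1 ?mul1r.
elim: N => [a|N IH a]; first by have [C gC] := mg a; exists C => x; rewrite mul1r.
have [C0 h0] := IH a.
have [C1 h1] : exists C, forall x, \sum_(j < n) bracket x ^+ N *
    `|(\prod_(i < n) x 0 i ^+ (a i + (i == j).*2)) * g x| <= C.
  by apply: finite_bounds => j; exact: IH.
exists (C0 + C1) => x.
have -> : bracket x ^+ N.+1 = bracket x ^+ N + bracket x ^+ N * dotr x x.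
  by rewrite exprSr {2}/bracket mulrDr mulr1.
rewrite mulrDl lerD//.
rewrite (le_trans _ (h1 x))// mulr_sumr mulr_suml; apply: ler_sum => j _.
rewrite -mulrA ler_wpM2l ?exprn_ge0 ?(ltW (bracket_gt0 _))//.
have -> : \prod_(i < n) x 0 i ^+ (a i + (i == j).*2) =
    (\prod_(i < n) x 0 i ^+ a i) * (x 0 j * x 0 j).
  under eq_bigr do rewrite exprD; rewrite big_split/=; congr (_ * _).
  rewrite (bigD1 j)//= eqxx big1 ?mulr1// => i /negPf ->.
  by rewrite expr0.
set A := \prod_(i < n) _; have -> : A * (x 0 j * x 0 j) * g x = x 0 j * x 0 j * (A * g
  x) by ring.
by rewrite [leRHS]normrM [X in _ <= X * _]ger0_norm// -expr2 sqr_ge0.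
Qed.

Lemma schwartzP f :
  schwartz f <-> smooth f /\ forall s, rapid (pderivs s f).
Proof.
split=> [[sf hf]|[sf hf]]; split => //; first by move=> s; apply/rapidP => a; exact: hf.
by move=> a s; have /rapidP := hf s; exact.
Qed.

Lemma schwartz_pderivs s f : schwartz f -> schwartz (pderivs s f).
Proof.
move=> /schwartzP[sf hf]; apply/schwartzP; split; first exact: smooth_pderivs.
by move=> s'; rewrite -pderivs_cat.
Qed.

Lemma schwartz_pderiv j f : schwartz f -> schwartz (pderiv j f).
Proof. exact: (@schwartz_pderivs [:: j]). Qed.

Lemma schwartz_smooth f : schwartz f -> smooth f.
Proof. by case. Qed.

Lemma schwartz_continuous f : schwartz f -> continuous f.
Proof. by move=> [sf _]; exact: smooth_continuous. Qed.

Lemma schwartz_rapid f : schwartz f -> rapid f.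
Proof. by move=> /schwartzP[_ /(_ [::])]. Qed.

Lemma rapid_lin (I : Type) (r : seq I) (c : I -> R) (f : I -> 'rV[R]_n -> R) :
  (forall i, rapid (f i)) -> rapid (fun x => \sum_(i <- r) c i * f i x).
Proof.
move=> rf N; elim: r => [|i r [C IH]].
  by exists 0 => x; rewrite big_nil normr0 mulr0.
have [D hD] := rf i N; exists (`|c i| * D + C) => x; rewrite big_cons.
have b0 : 0 <= bracket x ^+ N by rewrite exprn_ge0// ltW// bracket_gt0.
rewrite (le_trans (ler_wpM2l b0 (ler_normD _ _)))// mulrDr lerD//.
by rewrite normrM mulrCA ler_wpM2l.
Qed.

Lemma schwartz_lin (I : Type) (r : seq I) (c : I -> R) (f : I -> 'rV[R]_n -> R) :
  (forall i, schwartz (f i)) -> schwartz (fun x => \sum_(i <- r) c i * f i x).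
Proof.
move=> sf; apply/schwartzP; split.
  by apply: smooth_lin => i; exact: schwartz_smooth.
move=> s; rewrite pderivs_lin => [|i]; last exact: schwartz_smooth.
by apply: rapid_lin => i; exact/schwartz_rapid/schwartz_pderivs.
Qed.

Lemma schwartz_dirderiv v f : schwartz f -> schwartz (dirderiv v f).
Proof. by move=> sf; apply: schwartz_lin => j; exact: schwartz_pderiv. Qed.

(** A coordinate with [v_l != 0] recovers the parameter: [t = (z_l - y_l) / v_l] for [z = y + t v].
    The factor 4 comes from [(z_l - y_l)^2 <= 2 z_l^2 + 2 y_l^2], each square being at most
    [bracket y * bracket z]. *)
Lemma bracket_line v : v != 0 ->
  exists2 K, 0 <= K & forall y (t : R), 1 + t ^+ 2 <= K * bracket y * bracket (y + t *: v).
Proof.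
move=> v0; have [l vl] : exists l, v 0 l != 0.
  apply/existsP; apply: contraR v0; rewrite negb_exists => /forallP v0.
  by apply/eqP/rowP => l; have := v0 l; rewrite negbK mxE => /eqP.
have v2 : 0 < v 0 l ^+ 2 by rewrite exprn_even_gt0.
exists (1 + 4 / v 0 l ^+ 2); first by rewrite addr_ge0// divr_ge0// ltW.
move=> y t; set z := y + t *: v.
have tE : t ^+ 2 = (z 0 l - y 0 l) ^+ 2 / v 0 l ^+ 2.
  by rewrite /z !mxE addrAC subrr add0r exprMn mulfK// gt_eqF.
have z1 := bracket_ge1 z; have y1 := bracket_ge1 y.
have zl := dotr_coord z l; have yl := dotr_coord y l.
have p1 : 1 <= bracket y * bracket z by rewrite -[1]mulr1; apply: ler_pM.
have p2 : (z 0 l - y 0 l) ^+ 2 <= 4 * (bracket y * bracket z).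
  have h := sqr_ge0 (z 0 l + y 0 l).
  have e : (z 0 l - y 0 l) ^+ 2 = 2 * z 0 l ^+ 2 + 2 * y 0 l ^+ 2 - (z 0 l + y 0 l) ^+
    2 by ring.
  have q1 : bracket y <= bracket y * bracket z by rewrite ler_peMr//; lra.
  have q2 : bracket z <= bracket y * bracket z by rewrite ler_peMl//; lra.
  by rewrite e; move: q1 q2; rewrite /bracket; lra.
rewrite tE -mulrA mulrDl mul1r lerD// [leRHS]mulrAC ler_pM2r ?invr_gt0//.
Qed.

(** The explicit dependence on the base point makes the bound uniform for [y] in a bounded set, as
    differentiation under the integral requires. *)
Lemma rapid_line g v : v != 0 -> rapid g ->
  exists2 C, 0 <= C & forall y (t : R), `|g (y + t *: v)| <= C * bracket y * lorentz t.
Proof.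
move=> v0 rg; have [K K0 vK] := bracket_line v0; have [C C0 gC] := rapid_bound 1 rg.
exists (C * K); first exact: mulr_ge0.
move=> y t; rewrite (le_trans (gC _))// expr1 -!mulrA ler_wpM2l//.
rewrite /lorentz mulrA ler_pdivlMr; last by have := sqr_ge0 t; lra.
by rewrite mulrC ler_pdivrMr// bracket_gt0.
Qed.

Lemma continuous_line g x v : continuous g -> continuous (fun t : R => g (x + t *: v)).
Proof.
move=> cg t; apply: (@continuous_comp R 'rV[R]_n R (fun t : R => x + t *: v) g);
  last exact: cg.
apply: cvgD; first exact: cvg_cst.
by apply: cvgZr_tmp; exact: cvg_id.
Qed.

Lemma tame_line g x v : v != 0 -> continuous g -> rapid g ->
  tame (fun t : R => g (x + t *: v)).
Proof.
move=> v0 cg rg; split; first exact: continuous_line.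
by have [C _ gC] := rapid_line v0 rg; exists (C * bracket x).
Qed.

End schwartz.

(** * Integrals over half-lines *)

Lemma lipschitz_continuous (R : realType) (V : normedModType R) (F : V -> R) (K : R) :
  (forall x y, `|F x - F y| <= K * `|x - y|) -> continuous F.
Proof.
move=> FK x; apply/cvgrPdist_le => e e0.
have K1 : 0 < `|K| + 1 by rewrite ltr_wpDl.
near=> y; rewrite (le_trans (FK x y))//.
have hy : `|x - y| < e / (`|K| + 1).
  by near: y; apply: cvgr_dist_lt; [exact: cvg_id|exact: divr_gt0].
have h1 : K * `|x - y| <= (`|K| + 1) * `|x - y|.
  by rewrite ler_wpM2r// (le_trans (ler_norm _))// lerDl.
by rewrite (le_trans h1)// mulrC -ler_pdivlMr// ltW.
Unshelve. all: by end_near. Qed.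

Section half_line.
Context {R : realType} {n : nat}.
Notation mu := (@lebesgue_measure R).
Implicit Types (f g : 'rV[R]_n -> R) (x y v : 'rV[R]_n).

Definition half_ray v g x : R := Ihalf (fun t : R => g (x + t *: v)).

(** Each line of direction [v] is cut at [x] into two opposite rays, so that the integral over one
    ray is minus the integral over the other. *)
Definition null_lines v g := forall x, half_ray v g x + half_ray (- v) g x = 0.

Lemma null_linesP v g : v != 0 -> schwartz g ->
  null_lines v g <-> forall x, Iline (fun t : R => g (x + t *: v)) = 0.
Proof.
move=> v0 sg; have E x : Iline (fun t : R => g (x + t *: v)) = half_ray v g x +
  half_ray (- v) g x.
  rewrite Iline_half; last first.
    by apply: tame_line => //; [exact: schwartz_continuous|exact: schwartz_rapid].
  congr (_ + Ihalf _); apply/funext => t.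
  by rewrite scaleNr scalerN.
by split=> H x; have := H x; rewrite E.
Qed.

Lemma bracketD x y : bracket (x + y) <= 2 * bracket x * bracket y.
Proof.
have x1 := bracket_ge1 x; have y1 := bracket_ge1 y.
have h : 0 <= dotr (x - y) (x - y) by exact: dotr_sqr_ge0.
have e : dotr (x - y) (x - y) = dotr x x - 2 * dotr x y + dotr y y.
  rewrite dotr_sqrD [dotr x (- y)]dotrC dotrNl [dotr y x]dotrC.
  by rewrite [dotr (- y) (- y)]dotrNl [dotr y (- y)]dotrC dotrNl; ring.
have p : bracket x + bracket y <= bracket x * bracket y + 1.
  have : 0 <= (bracket x - 1) * (bracket y - 1) by rewrite mulr_ge0; lra.
  have -> : (bracket x - 1) * (bracket y - 1) = bracket x * bracket y - bracket x -
    bracket y + 1 by ring.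
  by lra.
have e2 : bracket (x + y) = 1 + dotr x x + 2 * dotr x y + dotr y y.
  by rewrite /bracket dotr_sqrD; ring.
have ex : bracket x = 1 + dotr x x by [].
have ey : bracket y = 1 + dotr y y by [].
by rewrite -mulrA; lra.
Qed.

Lemma half_is_derive v g (j : 'I_n) x : v != 0 -> schwartz g ->
  is_derive x (delta_mx 0 j : 'rV[R]_n) (half_ray v g) (half_ray v (pderiv j g) x).
Proof.
move=> v0 sg; set e := delta_mx 0 j : 'rV[R]_n; have sg' := schwartz_pderiv j sg.
pose f (h t : R) := g (x + h *: e + t *: v).
have df (h t : R) : is_derive h (1 : R) (f ^~ t) (pderiv j g (x + h *: e + t *: v)).
  have -> : f ^~ t = (fun h => g (x + t *: v + h *: e)).
    by apply/funext => h'; rewrite /f addrAC.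
  apply: (is_derive_line g (x + t *: v) e h _).1.
  by rewrite addrAC; apply: smooth_is_derive; exact: schwartz_smooth.
have [C C0 hC] := rapid_line v0 (schwartz_rapid sg').
(* For [|h| <= 1] the base point [x + h e] has weight at most [2 * bracket x * bracket e], which
   gives a majorant of the derivative independent of [h]. *)
pose K := C * (2 * bracket x * bracket e).
have b0 y : 0 <= bracket y by exact/ltW/bracket_gt0.
have K0 : 0 <= K by rewrite !mulr_ge0.
pose G := fun t : R => K * lorentz t.
have be (h : R) : `|h| <= 1 -> bracket (x + h *: e) <= 2 * bracket x * bracket e.
  move=> h1; rewrite (le_trans (bracketD _ _))// ler_wpM2l ?mulr_ge0//.
  rewrite /bracket lerD2l dotrZl dotrC dotrZl mulrA ler_piMl ?dotr_sqr_ge0//.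
  rewrite -expr2 -real_normK ?num_real// expr_le1//.
have tG : tame G by apply: tame_cst_mul; exact: tame_lorentz.
have tf h : tame (f h).
  by apply: tame_line => //; [exact: schwartz_continuous|exact: schwartz_rapid].
have := @cvg_differentiation_under_integral R _ _ mu f `[0,
  +oo[ (measurable_itv _) 0 (-1) 1 _ _ _ G.
have i0 : `](-1), 1[%classic (0 : R) by rewrite /= in_itv/=; apply/andP; split; lra.
move=> /(_ i0 (fun h _ => tame_integrable (measurable_itv _) (tf h))).
move=> /(_ (fun h t _ _ => @ex_derive _ _ _ _ _ _ _ (df h t))).
have Gge0 t : 0 <= G t by rewrite mulr_ge0 ?lorentz_ge0.
move=> /(_ Gge0 (tame_integrable (measurable_itv _) tG)).
have hG (h t : R) : `](-1), 1[%classic h -> `[0,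
  +oo[%classic t -> `|partial1of2 f h t| <= G t.
  rewrite /= in_itv/= => /andP[h1 h2] _.
  rewrite partial1of2E (@derive_val _ _ _ _ _ _ _ (df h t)).
  rewrite (le_trans (hC _ _))// /G ler_wpM2r ?lorentz_ge0// /K ler_wpM2l// be//.
  by rewrite ler_norml; apply/andP; split; lra.
move=> /(_ hG) H.
have H2 : is_derive (0 : R) (1 : R) (fun h => half_ray v g (x + h *: e)) (half_ray v
  (pderiv j g) x).
  apply/is_deriveP.
  have E : \int[mu]_(y in `[0, +oo[) partial1of2 f 0 y = half_ray v (pderiv j g) x.
    apply: eq_Rintegral => t _.
    by rewrite partial1of2E (@derive_val _ _ _ _ _ _ _ (df 0 t)) scale0r addr0.
  rewrite E in H; move: H.
  have -> // : (fun h : R => h^-1 *: ((fun x' : R => \int[mu]_(y in `[0,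
    +oo[) f x' y) (h + 0) -
     (fun x' : R => \int[mu]_(y in `[0, +oo[) f x' y) 0)) =
    (fun h : R => h^-1 *: (half_ray v g (x + (h *: (1 : R) + 0) *: e) - half_ray v g (x
      + (0 : R) *: e))).
  by apply/funext => h; rewrite /GRing.scale/= mulr1.
have := (is_derive_line (half_ray v g) x e 0 (half_ray v (pderiv j g) x)).2 H2.
by rewrite scale0r addr0.
Qed.

(** If [dotr x v >= 0], the ray from [x] along [v] moves away from the origin and [g] is small on
    all of it. Otherwise the opposite ray does, and [null_lines] exchanges the two. Of the [N + 1]
    powers of the weight, one pays for integrability in [t]. *)
Lemma half_rapid v g : v != 0 -> schwartz g -> null_lines v g -> rapid (half_ray v g).
Proof.
move=> v0 sg zg N; have d0 := dotr_gt0 v0.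
have [C C0 gC] := rapid_bound N.+1 (schwartz_rapid sg).
(* Chosen so that [c * (1 + t^2)] is at most the weight at parameter [t] of such a ray. *)
pose c := Num.min 1 (dotr v v).
have c0 : 0 < c by rewrite lt_min ltr01.
have key w x : dotr w w = dotr v v -> w != 0 -> 0 <= dotr x w ->
    `|half_ray w g x| <= (C / c) / bracket x ^+ N * (pi / 2).
  move=> wv w0 xw; apply: normr_Ihalf.
    by apply: tame_line => //; [exact: schwartz_continuous|exact: schwartz_rapid].
  move=> t t0; rewrite (le_trans (gC _))//.
  have e : bracket (x + t *: w) = bracket x + 2 * (t * dotr x w) + t ^+ 2 * dotr v v.
    rewrite /bracket dotr_sqrD [dotr x (t *: w)]dotrC !dotrZl [dotr w (t *: w)]dotrC.
    by rewrite dotrZl wv [dotr w x]dotrC; ring.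
  have txw : 0 <= t * dotr x w by exact: mulr_ge0.
  have b1 := bracket_ge1 x; have t2 := sqr_ge0 t.
  have td : 0 <= t ^+ 2 * dotr v v by rewrite mulr_ge0// ltW.
  have h1 : bracket x <= bracket (x + t *: w) by rewrite e; lra.
  have cd : c <= dotr v v by rewrite ge_min lexx orbT.
  have c1 : c <= 1 by rewrite ge_min lexx.
  have ctd : t ^+ 2 * c <= t ^+ 2 * dotr v v by rewrite ler_wpM2l.
  have h2 : c * (1 + t ^+ 2) <= bracket (x + t *: w) by rewrite e mulrDr mulr1 [c *
    _]mulrC; lra.
  have h3 : bracket x ^+ N * (c * (1 + t ^+ 2)) <= bracket (x + t *: w) ^+ N.+1.
    have bx := bracket_gt0 x.
    rewrite [leRHS]exprSr; apply: ler_pM => //; first by rewrite exprn_ge0// ltW.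
    - by rewrite mulr_ge0 ?(ltW c0)//; lra.
    - by rewrite lerXn2r ?nnegrE ?(ltW (bracket_gt0 _)).
  have -> : C / c / bracket x ^+ N * lorentz t = C / (bracket x ^+ N * (c * (1 + t ^+ 2))).
    by rewrite /lorentz !invfM; ring.
  rewrite ler_wpM2l// lef_pV2// posrE.
    by rewrite exprn_gt0// bracket_gt0.
  rewrite mulr_gt0 ?exprn_gt0 ?bracket_gt0// mulr_gt0//; lra.
exists ((C / c) * (pi / 2)) => x.
have bp : 0 < bracket x ^+ N by rewrite exprn_gt0// bracket_gt0.
rewrite mulrC -ler_pdivlMr//.
have -> : (C / c) * (pi / 2) / bracket x ^+ N = (C / c) / bracket x ^+ N * (pi / 2) by
  rewrite mulrAC.
have [xv|xv] := leP 0 (dotr x v); first exact: key.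
have -> : half_ray v g x = - half_ray (- v) g x by have := zg x; lra.
rewrite normrN; apply: key; rewrite ?oppr_eq0//.
- by rewrite dotrNl dotrC dotrNl opprK.
- by rewrite dotrC dotrNl oppr_ge0 dotrC ltW.
Qed.

Lemma null_lines_pderiv v g (j : 'I_n) : v != 0 -> schwartz g ->
  null_lines v g -> null_lines v (pderiv j g).
Proof.
move=> v0 sg zg x; have d1 := half_is_derive j x v0 sg.
have nv0 : - v != 0 by rewrite oppr_eq0.
have d2 := half_is_derive j x nv0 sg.
have := is_deriveD d1 d2.
have -> : half_ray v g + half_ray (- v) g = cst 0 by apply/funext => y; exact: zg.
move=> d3; rewrite -(@derive_val _ _ _ _ _ _ _ d3).
exact: derive_cst.
Qed.

(** Moving one coordinate at a time, the mean value theorem gives a Lipschitz bound; the maximum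
    norm dominates each coordinate. *)
Lemma bounded_pderiv_continuous (F : 'rV[R]_n -> R) (F' : 'I_n -> 'rV[R]_n -> R) :
  (forall j x, is_derive x (delta_mx 0 j : 'rV[R]_n) F (F' j x)) ->
  (forall j, exists C, forall x, `|F' j x| <= C) -> continuous F.
Proof.
move=> dF /choice[C FC].
have lip (r : seq 'I_n) v x :
    `|F (x + \sum_(j <- r) v 0 j *: delta_mx 0 j) - F x| <= \sum_(j <- r) C j * `|v 0 j|.
  elim: r x => [|j r IH] x; first by rewrite !big_nil addr0 subrr normr0.
  rewrite !big_cons; set w := \sum_(i <- r) _; set y := x + v 0 j *: delta_mx 0 j.
  have -> : F (x + (v 0 j *: delta_mx 0 j + w)) - F x = (F y - F x) + (F (y + w) - F y).
    by rewrite /y addrA; ring.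
  rewrite (le_trans (ler_normD _ _))// lerD//.
  have [c _] := MVT0 (v 0 j) (fun t => (is_derive_line F x (delta_mx 0 j) t _).1 (dF j _)).
  by rewrite scale0r addr0 => ->; rewrite normrM ler_wpM2r.
have C0 j : 0 <= C j by rewrite (le_trans _ (FC j 0)).
apply: (@lipschitz_continuous _ _ _ (\sum_(j < n) C j)) => x y.
have -> : F x - F y = - (F (x + \sum_(j < n) (y - x) 0 j *: delta_mx 0 j) - F x).
  by rewrite -row_sum_delta [x + _]addrC subrK opprB.
rewrite normrN (le_trans (lip _ _ _))// mulr_suml.
apply: ler_sum => j _; rewrite ler_wpM2l// distrC.
by rewrite [leRHS]/Num.Def.normr/= mx_normrE; apply/bigmax_geP; right => /=; exists (0, j).
Qed.

(** [smooth_closed] applies to the half-line integrals, in the direction [v], of Schwartz functions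
    satisfying [null_lines]: differentiation passes to the integrand and preserves both
    conditions. *)
Lemma schwartz_half v g : v != 0 -> schwartz g -> null_lines v g -> schwartz (half_ray v g).
Proof.
move=> v0 sg zg.
pose P F := exists g, [/\ schwartz g, null_lines v g & F = half_ray v g].
have Pd F j : P F -> exists2 G, P G & forall x,
  is_derive x (delta_mx 0 j : 'rV[R]_n) F (G x).
  move=> [h [sh zh ->]]; exists (half_ray v (pderiv j h)).
    exists (pderiv j h); split => //; first exact: schwartz_pderiv.
    exact: null_lines_pderiv.
  by move=> x; exact: half_is_derive.
have Pr F : P F -> rapid F by move=> [h [sh zh ->]]; exact: half_rapid.
have Pc F : P F -> continuous F.
  move=> [h [sh zh ->]].
  apply: (@bounded_pderiv_continuous (half_ray v h) (fun j => half_ray v (pderiv j h))).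
    by move=> j x; exact: half_is_derive.
  move=> j; have : rapid (half_ray v (pderiv j h)).
    by apply: half_rapid; [|exact: schwartz_pderiv|exact: null_lines_pderiv].
  by move=> /(_ 0%N)[C hC]; exists C => x; have := hC x; rewrite mul1r.
have [sF rF] := smooth_closed Pc Pd (ex_intro _ g (And3 sg zg erefl)).
by apply/schwartzP; split => // s; exact/Pr/rF.
Qed.

Lemma dirderiv_half v g x : v != 0 -> schwartz g ->
  dirderiv v (half_ray v g) x = - g x.
Proof.
move=> v0 sg.
have tp j : tame (fun t : R => pderiv j g (x + t *: v)).
  by apply: tame_line => //;
    [exact: schwartz_continuous (schwartz_pderiv j sg)|exact: schwartz_rapid
      (schwartz_pderiv j sg)].
have -> : dirderiv v (half_ray v g) x = half_ray v (dirderiv v g) x.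
  rewrite /half_ray /dirderiv Ihalf_sum; last by move=> j; apply: tame_cst_mul.
  apply: eq_bigr => j _; rewrite IhalfZ//; congr (_ * _).
  exact: (@derive_val _ _ _ _ _ _ _ (half_is_derive j x v0 sg)).
have tg : tame (fun t : R => g (x + t *: v)).
  by apply: tame_line => //; [exact: schwartz_continuous|exact: schwartz_rapid].
(* [- g x] is read as the limit [0] at infinity minus the value at [t = 0] of [g (x + t *: v)]. *)
rewrite /half_ray -[RHS]sub0r -[in RHS](addr0 x) -(scale0r v).
apply: (@Ihalf_FTC _ _ (fun t : R => g (x + t *: v)) 0).
- have sd := schwartz_dirderiv v sg.
  by apply: tame_line => //; [exact: schwartz_continuous|exact: schwartz_rapid].
- by case: tg.
- by move=> t _; apply: smooth_line; exact: schwartz_smooth.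
- exact: tame_cvgy.
Qed.

End half_line.

(** * Fourier transform on planes *)

Section planes.
Context {R : realType} {n : nat}.
Implicit Types (g : 'rV[R]_n -> R) (x y v xi : 'rV[R]_n).

Definition contract m (f : tensor_field R n m) xi x : R :=
  \sum_(i : {ffun 'I_m -> 'I_n}) f i x * \prod_(j < m) xi 0 (i j).

Lemma schwartz_contract m (f : tensor_field R n m) xi :
  (forall i, schwartz (f i)) -> schwartz (contract f xi).
Proof.
move=> sf; have := schwartz_lin (index_enum {ffun 'I_m -> 'I_n})
  (fun i => \prod_(j < m) xi 0 (i j)) sf.
by congr schwartz; apply/funext => x; apply: eq_bigr => i _; rewrite mulrC.
Qed.

Lemma schwartzN g : schwartz g -> schwartz (fun x => - g x).
Proof.
move=> sg; have := schwartz_lin [:: tt] (fun=> -1) (fun=> sg).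
by congr schwartz; apply/funext => x; rewrite big_seq1 mulN1r.
Qed.

Definition plane x xi (j : 'I_n) g (a b : R) : R :=
  g (x + a *: xi + b *: delta_mx 0 j).

(** The coordinate [l] makes [xi] and [e_j] independent. At [z = x + a xi + b e_j], [z_l] determines
    [a] and then [z_j] determines [b], so one power of the weight controls each Lorentzian
    factor. *)
Lemma tame2_plane x xi (j l : 'I_n) g : l != j -> xi 0 l != 0 -> schwartz g ->
  tame2 (plane x xi j g).
Proof.
move=> lj xil sg; split.
  move=> p; apply: (@continuous_comp (R * R)%type 'rV[R]_n R
    (fun p => x + p.1 *: xi + p.2 *: delta_mx 0 j) g); last exact: schwartz_continuous.
  apply: cvgD; first apply: cvgD; first exact: cvg_cst.
    by apply: cvgZr_tmp; exact: cvg_fst.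
  by apply: cvgZr_tmp; exact: cvg_snd.
have [C C0 gC] := rapid_bound 2 (schwartz_rapid sg).
set u := xi 0 l in xil.
have u2 : 0 < u ^+ 2 by rewrite exprn_even_gt0.
(* [K1] comes from [a = (z_l - x_l) / u] and [K2] from [b = z_j - x_j - a xi_j], the squares being
   bounded by 2 and 3 times the sums of the squares of the terms. *)
pose K1 := 1 + 2 * (1 + x 0 l ^+ 2) / u ^+ 2.
pose K2 := 1 + 3 * (1 + x 0 j ^+ 2 + K1 * xi 0 j ^+ 2).
have K10 : 0 <= K1 by rewrite addr_ge0// divr_ge0 ?(ltW u2)//; have := sqr_ge0 (x 0 l); lra.
have K20 : 0 <= K2.
  have : 0 <= K1 * xi 0 j ^+ 2 by rewrite mulr_ge0// sqr_ge0.
  by rewrite /K2; have := sqr_ge0 (x 0 j); lra.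
exists (C * (K1 * K2)) => a b; rewrite /plane; set z := x + _ + _.
have z1 := bracket_ge1 z.
have zl : z 0 l = x 0 l + a * u by rewrite /z !mxE eqxx (negPf lj) mulr0 addr0.
have zj : z 0 j = x 0 j + a * xi 0 j + b by rewrite /z !mxE !eqxx mulr1.
have hl := dotr_coord z l; have hj := dotr_coord z j.
have hl' : z 0 l ^+ 2 <= bracket z by rewrite (le_trans hl)// /bracket lerDr.
have hj' : z 0 j ^+ 2 <= bracket z by rewrite (le_trans hj)// /bracket lerDr.
have xl0 := sqr_ge0 (x 0 l); have xj0 := sqr_ge0 (x 0 j).
have ha : 1 + a ^+ 2 <= K1 * bracket z.
  have -> : a ^+ 2 = (z 0 l - x 0 l) ^+ 2 / u ^+ 2.
    by rewrite zl addrAC subrr add0r exprMn mulfK// gt_eqF.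
  rewrite /K1 mulrDl mul1r lerD// [leRHS]mulrAC ler_pM2r ?invr_gt0//.
  have := sqr_ge0 (z 0 l + x 0 l).
  have -> : (z 0 l + x 0 l) ^+ 2 = 2 * z 0 l ^+ 2 + 2 * x 0 l ^+ 2 - (z 0 l - x 0 l) ^+
    2 by ring.
  have : x 0 l ^+ 2 <= x 0 l ^+ 2 * bracket z by rewrite ler_peMr.
  have -> : 2 * (1 + x 0 l ^+ 2) * bracket z = 2 * bracket z + 2 * (x 0 l ^+ 2 *
    bracket z) by ring.
  by lra.
clearbody K1.
have hb : 1 + b ^+ 2 <= K2 * bracket z.
  have -> : b = z 0 j - x 0 j - a * xi 0 j by rewrite zj; ring.
  rewrite /K2 mulrDl mul1r lerD//.
  have a2 : a ^+ 2 <= K1 * bracket z by move: ha; lra.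
  have axi : (a * xi 0 j) ^+ 2 <= K1 * xi 0 j ^+ 2 * bracket z.
    by rewrite exprMn [leRHS]mulrAC ler_wpM2r// sqr_ge0.
  have h3 (p q r : R) : (p - q - r) ^+ 2 <= 3 * (p ^+ 2 + q ^+ 2 + r ^+ 2).
    have e : 3 * (p ^+ 2 + q ^+ 2 + r ^+ 2) - (p - q - r) ^+ 2 =
       (p + q) ^+ 2 + (p + r) ^+ 2 + (q - r) ^+ 2 by ring.
    by have := sqr_ge0 (p + q); have := sqr_ge0 (p + r); have := sqr_ge0 (q - r); lra.
  rewrite (le_trans (h3 _ _ _))// -mulrA ler_wpM2l// !mulrDl mul1r !lerD//.
  by rewrite ler_peMr.
clearbody K2.
rewrite (le_trans (gC z))// -!mulrA ler_wpM2l// /lorentz.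
have pa : 0 < 1 + a ^+ 2 by have := sqr_ge0 a; lra.
have pb : 0 < 1 + b ^+ 2 by have := sqr_ge0 b; lra.
have -> : K1 * (K2 * ((1 + a ^+ 2)^-1 * (1 + b ^+ 2)^-1)) = K1 * K2 / ((1 + a ^+ 2) *
  (1 + b ^+ 2)).
  by rewrite invfM; ring.
rewrite ler_pdivlMr ?mulr_gt0// mulrC ler_pdivrMr ?exprn_gt0 ?bracket_gt0//.
have -> : K1 * K2 * bracket z ^+ 2 = (K1 * bracket z) * (K2 * bracket z) by ring.
by apply: ler_pM => //; exact: ltW.
Qed.

(* A polynomial [A] with root [- y1 / y2] is divided by [y1 + s y2]. *)
Lemma poly_divided_difference m (A : {poly R}) (T : R -> R) (y1 y2 : R) N (c s : 'I_N
  -> R) :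
  (size A <= m.+1)%N -> y2 != 0 -> (forall t, A.[t] = (y1 + t * y2) * T t) ->
  (forall i, y1 + s i * y2 != 0) ->
  (forall q : {poly R}, (size q <= m)%N -> \sum_i c i * q.[s i] = 0) ->
  \sum_i c i * T (s i) = 0.
Proof.
move=> sA y20 AT sn0 cq; pose r := - y1 / y2.
have : root A r by rewrite rootE AT /r divfK// subrr mul0r.
move=> /factor_theorem[q Aq].
have sq : (size q <= m)%N.
  have [->|q0] := eqVneq q 0; first by rewrite size_poly0.
  by move: sA; rewrite Aq size_Mmonic ?monicXsubC// size_XsubC addn2.
have -> : \sum_i c i * T (s i) = y2^-1 * \sum_i c i * q.[s i].
  rewrite mulr_sumr; apply: eq_bigr => i _.
  have := AT (s i); rewrite Aq hornerM hornerXsubC.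
  have -> : s i - r = (y1 + s i * y2) / y2 by rewrite /r; field.
  rewrite [RHS]mulrC => E; have -> : T (s i) = q.[s i] / y2; last by ring.
  apply: (mulIf (sn0 i)); rewrite -E; ring.
by rewrite cq// mulr0.
Qed.

(** * The half-line potential as a function of the direction *)

Section potential.
Context {m : nat}.
Variable f : tensor_field R n m.
Hypothesis sf : forall i, schwartz (f i).
Hypothesis zf : forall xi, xi != 0 -> null_lines xi (contract f xi).

Definition potential xi x : R := - half_ray xi (contract f xi) x.

Lemma schwartz_potential xi : xi != 0 -> schwartz (potential xi).
Proof.
by move=> xi0; apply: schwartzN; apply: schwartz_half;
  [|exact: schwartz_contract|exact: zf].
Qed.

Lemma potential_is_derive xi x : xi != 0 ->
  is_derive x xi (potential xi) (contract f xi x).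
Proof.
move=> xi0; have sc := schwartz_contract xi sf.
have sh := schwartz_half xi0 sc (zf xi0).
have := is_deriveN (smooth_dirderiv xi x (schwartz_smooth sh)).
by rewrite dirderiv_half// opprK.
Qed.

(** Polynomial dependence on [s], of degree less than [m], is stated dually so that, being linear,
    it passes through the Fourier transform. The coordinate [l] keeps [xi + s e_j] nonzero and
    independent of [e_j] for every [s]. *)
Lemma potential_divided_difference (j l : 'I_n) xi N (c s : 'I_N -> R) :
  l != j -> xi 0 l != 0 ->
  (forall q : {poly R}, (size q <= m)%N -> \sum_i c i * q.[s i] = 0) ->
  forall x, \sum_i c i * potential (xi + s i *: delta_mx 0 j) x = 0.
Proof.
move=> lj xil cq x; set e := delta_mx 0 j : 'rV[R]_n.
pose dir (t : R) := xi + t *: e.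
have dirl t : dir t 0 l = xi 0 l by rewrite !mxE eqxx (negPf lj) mulr0 addr0.
have dir0 t : dir t != 0.
  by apply: contra xil => /eqP d0; rewrite -(dirl t) d0 mxE.
(* The plane and its coordinates come from [xi] and [e_j] for every [t]; only the function on it
   varies, so that the functions [P (s i)] can be added. *)
pose P t := plane x xi j (potential (dir t)).
pose F t := plane x xi j (contract f (dir t)).
have tP t : tame2 (P t) by apply: tame2_plane lj xil _; exact: schwartz_potential.
have tF t : tame2 (F t) by apply: tame2_plane lj xil _; exact: schwartz_contract.
have shear t g a b : plane x xi j g a (b + t * a) = plane x (dir t) j g a b.
  rewrite /plane /dir; congr g.
  by rewrite scalerDr scalerDl -!addrA scalerA [t * a]mulrC; congr (_ + (_ + _));
    rewrite addrC.
have dirl' t : dir t 0 l != 0 by rewrite dirl.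
have T t := @transform_shear R (P t) (F t) t (tP t) (tF t).
have {}T t (y1 y2 : R) :
    cos_transform (F t) y1 y2 = (y1 + t * y2) * sin_transform (P t) y1 y2 /\
    sin_transform (F t) y1 y2 = - (y1 + t * y2) * cos_transform (P t) y1 y2.
  apply: T.
  - rewrite (_ : (fun _ _ => _) = plane x (dir t) j (potential (dir t))).
      by apply: tame2_plane lj (dirl' t) _; exact: schwartz_potential.
    by apply/funext => a; apply/funext => b; exact: shear.
  - rewrite (_ : (fun _ _ => _) = plane x (dir t) j (contract f (dir t))).
      by apply: tame2_plane lj (dirl' t) _; exact: schwartz_contract.
    by apply/funext => a; apply/funext => b; exact: shear.
  - move=> a b; rewrite /F shear /plane addrAC.
    have -> : (fun a => P t a (b + t * a)) = (fun a => potential (dir t) (x + b *: e +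
      a *: dir t)).
      by apply/funext => a'; rewrite /P shear /plane addrAC.
    apply: (is_derive_line _ _ _ _ _).1.
    exact: potential_is_derive.
pose lin (i : {ffun 'I_m -> 'I_n}) (k : 'I_m) : {poly R} :=
  (xi 0 (i k))%:P + e 0 (i k) *: 'X.
(* The transform of [f . (xi + t e_j)^m] as a polynomial in [t]: the plane being fixed, its
   coefficients involve only transforms of the components of [f]. *)
pose A (tr : (R -> R -> R) -> R -> R -> R) (y1 y2 : R) : {poly R} :=
  \sum_(i : {ffun 'I_m -> 'I_n}) tr (plane x xi j (f i)) y1 y2 *:
     \prod_(k < m) lin i k.
have sA tr (y1 y2 : R) : (size (A tr y1 y2) <= m.+1)%N.
  rewrite /A; apply: (leq_trans (size_sum _ _ _)); apply/bigmax_leqP => i _.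
  apply: (leq_trans (size_scale_leq _ _)).
  apply: (leq_trans (size_prod_leq _ _)).
  have h : (\sum_(k < m) size (lin i k) <= \sum_(k < m) 2)%N.
    apply: leq_sum => k _; apply: (leq_trans (size_polyD _ _)); rewrite geq_max.
    rewrite (leq_trans (size_polyC_leq1 _))//=.
    by rewrite (leq_trans (size_scale_leq _ _))// size_polyX.
  move: h; rewrite sum_nat_const card_ord; set S := (\sum_(k < m) _)%N.
  by rewrite leq_subLR => h; rewrite addnS ltnS (leq_trans h)// muln2 addnn.
have hprod t i : (\prod_(k < m) lin i k).[t] = \prod_(k < m) dir t 0 (i k).
  rewrite horner_prod; apply: eq_bigr => k _.
  by rewrite /lin hornerD hornerC hornerZ hornerX /dir !mxE mulrC.
have tfi i : tame2 (plane x xi j (f i)) by apply: tame2_plane lj xil _; exact: sf.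
have hA_cos t (y1 y2 : R) : (A cos_transform y1 y2).[t] = cos_transform (F t) y1 y2.
  rewrite /A horner_sum /cos_transform.
  rewrite (eq_bigr (fun i : {ffun 'I_m -> 'I_n} => Iplane (fun a b => (\prod_(k < m)
    dir t 0 (i k)) *
      (plane x xi j (f i) a b * cos (a * y1 + b * y2))))); last first.
    by move=> i _; rewrite hornerZ hprod mulrC IplaneZ//; exact: tame2_cos.
  rewrite -Iplane_sum; last by move=> i; apply/tame2_cst_mul/tame2_cos.
  congr Iplane; apply/funext => a; apply/funext => b.
  rewrite /F /plane /contract mulr_suml; apply: eq_bigr => i _.
  by rewrite mulrA [_ * f i _]mulrC.
have hA_sin t (y1 y2 : R) : (A sin_transform y1 y2).[t] = sin_transform (F t) y1 y2.
  rewrite /A horner_sum /sin_transform.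
  rewrite (eq_bigr (fun i : {ffun 'I_m -> 'I_n} => Iplane (fun a b => (\prod_(k < m)
    dir t 0 (i k)) *
      (plane x xi j (f i) a b * sin (a * y1 + b * y2))))); last first.
    by move=> i _; rewrite hornerZ hprod mulrC IplaneZ//; exact: tame2_sin.
  rewrite -Iplane_sum; last by move=> i; apply/tame2_cst_mul/tame2_sin.
  congr Iplane; apply/funext => a; apply/funext => b.
  rewrite /F /plane /contract mulr_suml; apply: eq_bigr => i _.
  by rewrite mulrA [_ * f i _]mulrC.
pose g (a b : R) := \sum_i c i * P (s i) a b.
have tg : tame2 g by apply: tame2_sum => i; exact: tame2_cst_mul.
(* For given [y2], the finitely many [y1] at which some factor [y1 + s_i y2] vanishes. *)
pose B (y2 : R) := [seq - (s i * y2) | i <- enum 'I_N].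
have gcos (y1 y2 : R) : cos_transform g y1 y2 = \sum_i c i * cos_transform (P (s i)) y1 y2.
  rewrite /cos_transform.
  rewrite [RHS](eq_bigr (fun i : 'I_N => Iplane (fun a b => c i *
      (P (s i) a b * cos (a * y1 + b * y2))))); last first.
    by move=> i _; rewrite IplaneZ//; exact: tame2_cos.
  rewrite -Iplane_sum; last by move=> i; apply/tame2_cst_mul/tame2_cos.
  congr Iplane; apply/funext => a; apply/funext => b.
  by rewrite /g mulr_suml; apply: eq_bigr => i _; rewrite mulrA.
have gsin (y1 y2 : R) : sin_transform g y1 y2 = \sum_i c i * sin_transform (P (s i)) y1 y2.
  rewrite /sin_transform.
  rewrite [RHS](eq_bigr (fun i : 'I_N => Iplane (fun a b => c i *
      (P (s i) a b * sin (a * y1 + b * y2))))); last first.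
    by move=> i _; rewrite IplaneZ//; exact: tame2_sin.
  rewrite -Iplane_sum; last by move=> i; apply/tame2_cst_mul/tame2_sin.
  congr Iplane; apply/funext => a; apply/funext => b.
  by rewrite /g mulr_suml; apply: eq_bigr => i _; rewrite mulrA.
have : g 0 0 = 0.
  apply: (@fourier_inj2 R g B tg) => y1 y2 y20 y1B.
  have sn0 i : y1 + s i * y2 != 0.
    apply: contra y1B => /eqP h; apply/mapP; exists i; first by rewrite mem_enum.
    by apply/eqP; rewrite -addr_eq0 h.
  rewrite gcos gsin; split.
    (* Integration by parts exchanges cosine and sine: the cosine transform of the potential is the
       quotient of minus the sine transform of the contraction. *)
    apply: (@poly_divided_difference m (- A sin_transform y1 y2) (fun t =>
      cos_transform (P t) y1 y2) y1 y2) => //.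
      by rewrite size_polyN.
    by move=> t; rewrite hornerN hA_sin (T t y1 y2).2 mulNr opprK.
  apply: (@poly_divided_difference m (A cos_transform y1 y2) (fun t => sin_transform (P
    t) y1 y2) y1 y2) => //.
  by move=> t; rewrite hA_cos (T t y1 y2).1.
by rewrite /g /P /plane !scale0r !addr0.
Qed.

End potential.
End planes.

(** * Forms and polarization *)

Section forms.
Context {R : numFieldType} {n : nat}.
Implicit Types (F G W : 'rV[R]_n -> R) (xi : 'rV[R]_n).

Definition monomial e xi (i : {ffun 'I_e -> 'I_n}) : R := \prod_(k < e) xi 0 (i k).

Definition form e G : Prop :=
  exists u : {ffun 'I_e -> 'I_n} -> R, forall xi, G xi = \sum_i u i * monomial xi i.

Lemma sum_ffun_recr p (V : nmodType) (F : 'I_n -> {ffun 'I_p -> 'I_n} -> V) :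
  \sum_(i : {ffun 'I_p.+1 -> 'I_n})
     F (i ord_max) [ffun k => i (widen_ord (leqnSn p) k)] =
  \sum_(j < n) \sum_(i : {ffun 'I_p -> 'I_n}) F j i.
Proof.
rewrite pair_big/=.
pose h (ji : 'I_n * {ffun 'I_p -> 'I_n}) : {ffun 'I_p.+1 -> 'I_n} :=
  [ffun k => if insub (val k) is Some k' then ji.2 k' else ji.1].
have hmax ji : h ji ord_max = ji.1.
  by rewrite ffunE insubF//= ltnn.
have hw ji : [ffun k => h ji (widen_ord (leqnSn p) k)] = ji.2.
  by apply/ffunP => k; rewrite !ffunE/= insubT//= => kp; congr (_ _); apply: val_inj.
rewrite (reindex h); first by apply: eq_bigr => ji _; rewrite hmax hw.
exists (fun i : {ffun 'I_p.+1 -> 'I_n} => (i ord_max,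
  [ffun k => i (widen_ord (leqnSn p) k)])) => [ji _|i _].
  by rewrite hmax hw; case: ji.
apply/ffunP => k; rewrite ffunE/=; case: insubP => [k' _ kk'|].
  by rewrite ffunE; congr (i _); apply: val_inj.
by rewrite -leqNgt => pk; congr (i _); apply: val_inj => /=; apply/eqP;
  rewrite eqn_leq pk -ltnS ltn_ord.
Qed.

Lemma form_cst (c : R) : form 0 (fun=> c).
Proof.
exists (fun=> c) => xi; rewrite (eq_bigr (fun=> c)) => [|i _].
  by rewrite sumr_const card_ffun !card_ord expn0 mulr1n.
by rewrite /monomial big_ord0 mulr1.
Qed.

Lemma form0 e : form e (fun=> 0).
Proof. by exists (fun=> 0) => xi; rewrite big1// => i _; rewrite mul0r. Qed.

Lemma formD e F G : form e F -> form e G -> form e (fun xi => F xi + G xi).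
Proof.
move=> [u Fu] [w Gw]; exists (fun i => u i + w i) => xi.
by rewrite Fu Gw -big_split/=; apply: eq_bigr => i _; rewrite mulrDl.
Qed.

Lemma formZ e (c : R) F : form e F -> form e (fun xi => c * F xi).
Proof.
move=> [u Fu]; exists (fun i => c * u i) => xi.
by rewrite Fu mulr_sumr; apply: eq_bigr => i _; rewrite mulrA.
Qed.

Lemma monomial_recr p xi (i : {ffun 'I_p.+1 -> 'I_n}) :
  monomial xi i =
  monomial xi [ffun k => i (widen_ord (leqnSn p) k)] * xi 0 (i ord_max).
Proof.
by rewrite /monomial big_ord_recr/=; congr (_ * _); apply: eq_bigr => k _; rewrite ffunE.
Qed.

Lemma form_mulX e (j : 'I_n) F : form e F -> form e.+1 (fun xi => xi 0 j * F xi).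
Proof.
move=> [u Fu]; exists (fun i => (i ord_max == j)%:R * u [ffun k => i (widen_ord (leqnSn
  e) k)]) => xi.
pose Fj (j' : 'I_n) (i' : {ffun 'I_e -> 'I_n}) :=
  (j' == j)%:R * u i' * (monomial xi i' * xi 0 j').
rewrite (eq_bigr (fun i : {ffun 'I_e.+1 -> 'I_n} =>
   Fj (i ord_max) [ffun k => i (widen_ord (leqnSn e) k)])); last first.
  by move=> i _; rewrite monomial_recr.
rewrite (sum_ffun_recr Fj) (bigD1 j)//= [X in _ + X]big1 ?addr0; last first.
  by move=> j' /negPf j'j; rewrite big1// => i _; rewrite /Fj j'j !mul0r.
rewrite Fu mulr_sumr; by apply: eq_bigr => i _; rewrite /Fj eqxx mul1r; ring.
Qed.

Lemma monomialZ e (t : R) xi (i : {ffun 'I_e -> 'I_n}) :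
  monomial (t *: xi) i = t ^+ e * monomial xi i.
Proof.
rewrite /monomial -[in t ^+ e](card_ord e) -prodr_const -big_split/=.
by apply: eq_bigr => k _; rewrite mxE.
Qed.

Lemma formZ_hom e F (t : R) xi : form e F -> F (t *: xi) = t ^+ e * F xi.
Proof.
move=> [u Fu]; rewrite !Fu mulr_sumr; apply: eq_bigr => i _.
by rewrite monomialZ mulrCA.
Qed.

(** * Polynomial functions and interpolation *)

Definition polyfun F : Prop := exists N (G : nat -> 'rV[R]_n -> R),
  (forall e, form e (G e)) /\ forall xi, F xi = \sum_(e < N) G e xi.

Lemma polyfun_cst (c : R) : polyfun (fun=> c).
Proof.
exists 1%N, (fun e => if e is 0 then fun=> c else fun=> 0); split.
  by case=> [|e]; [exact: form_cst|exact: form0].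
by move=> xi; rewrite big_ord1.
Qed.

Lemma polyfunD F G : polyfun F -> polyfun G -> polyfun (fun xi => F xi + G xi).
Proof.
move=> [N [F' [fF FE]]] [M [G' [fG GE]]].
pose F2 e := if (e < N)%N then F' e else fun=> 0.
pose G2 e := if (e < M)%N then G' e else fun=> 0.
exists (N + M)%N, (fun e xi => F2 e xi + G2 e xi); split.
  by move=> e; apply: formD; rewrite /F2 /G2; case: ifP => _ //; exact: form0.
move=> xi; rewrite big_split/= FE GE; congr (_ + _).
  rewrite big_split_ord/= [X in _ + X]big1 ?addr0; last first.
    by move=> i _; rewrite /F2 ltnNge leq_addr.
  by apply: eq_bigr => i _; rewrite /F2 ltn_ord.
rewrite addnC big_split_ord/= [X in _ + X]big1 ?addr0; last first.
  by move=> i _; rewrite /G2 ltnNge leq_addr.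
by apply: eq_bigr => i _; rewrite /G2 ltn_ord.
Qed.

Lemma polyfunZ (c : R) F : polyfun F -> polyfun (fun xi => c * F xi).
Proof.
move=> [N [F' [fF FE]]]; exists N, (fun e xi => c * F' e xi); split.
  by move=> e; exact: formZ.
by move=> xi; rewrite FE mulr_sumr.
Qed.

Lemma polyfun_mulX (j : 'I_n) F : polyfun F -> polyfun (fun xi => xi 0 j * F xi).
Proof.
move=> [N [F' [fF FE]]].
exists N.+1, (fun e xi => if e is e'.+1 then xi 0 j * F' e' xi else 0); split.
  by case=> [|e]; [exact: form0|exact: form_mulX].
by move=> xi; rewrite big_ord_recl add0r FE mulr_sumr.
Qed.

Lemma polyfun_sum (I : Type) (r : seq I) (F : I -> 'rV[R]_n -> R) :
  (forall i, polyfun (F i)) -> polyfun (fun xi => \sum_(i <- r) F i xi).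
Proof.
move=> pF; elim: r => [|i r IH].
  by under eq_fun do rewrite big_nil; exact: polyfun_cst.
by under eq_fun do rewrite big_cons; exact: polyfunD.
Qed.

Lemma polyfun_mul_horner (j : 'I_n) (p : {poly R}) F :
  polyfun F -> polyfun (fun xi => p.[xi 0 j] * F xi).
Proof.
move=> pF; elim/poly_ind: p => [|p c IH].
  by under eq_fun do rewrite horner0 mul0r; exact: polyfun_cst.
under eq_fun do rewrite hornerMXaddC mulrDl mulrAC mulrC.
by apply: polyfunD; [exact: polyfun_mulX|exact: polyfunZ].
Qed.

Lemma poly_eq0_nodes (p : {poly R}) d : (size p <= d)%N ->
  (forall i : 'I_d, p.[i%:R] = 0) -> p = 0.
Proof.
move=> sp p0; apply/eqP; apply: contraLR (sp) => pn0; rewrite -ltnNge.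
have := @max_poly_roots _ p [seq (i%:R : R) | i <- iota 0 d] pn0.
rewrite size_map size_iota; apply.
  apply/allP => x /mapP[i]; rewrite mem_iota/= add0n => id ->.
  by rewrite rootE (p0 (Ordinal id)).
by rewrite map_inj_uniq ?iota_uniq// => i j /eqP; rewrite eqr_nat => /eqP.
Qed.

(** The Lagrange basis for the nodes [0, ..., d - 1], distinct in characteristic zero. *)
Definition node_basis d (a : 'I_d) : {poly R} :=
  \prod_(b < d | b != a) ((a%:R - b%:R)^-1 *: ('X - (b%:R)%:P)).

Lemma node_basisE d (a b : 'I_d) : (node_basis a).[b%:R] = (a == b)%:R.
Proof.
rewrite /node_basis horner_prod; have [->|ab] := eqVneq a b.
  rewrite big1// => c cb; rewrite hornerZ hornerXsubC mulVf// subr_eq0 eqr_nat.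
  by rewrite eq_sym; exact: cb.
by rewrite (bigD1 b) 1?eq_sym//= hornerZ hornerXsubC subrr mulr0 mul0r.
Qed.

Lemma size_node_basis d (a : 'I_d) : (size (node_basis a) <= d)%N.
Proof.
rewrite /node_basis; apply: (leq_trans (size_prod_leq _ _)).
have h : (\sum_(b < d | b != a) size ((a%:R - b%:R)^-1 *: ('X - (b%:R)%:P) : {poly R}) <=
     \sum_(b < d | b != a) 2)%N.
  by apply: leq_sum => b _; rewrite (leq_trans (size_scale_leq _ _))// size_XsubC.
have c : #|[pred b : 'I_d | b != a]| = d.-1 by rewrite cardC1 card_ord.
move: h; rewrite sum_nat_const c; set S := (\sum_(b < d | _) _)%N => h.
rewrite leq_subLR; case: d a S h c => [[]//|d] a S h c /=.
by rewrite addnS ltnS (leq_trans h)//= muln2 -addnn.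
Qed.

Lemma poly_interpolation d (p : {poly R}) t : (size p <= d)%N ->
  p.[t] = \sum_(a < d) (node_basis a).[t] * p.[a%:R].
Proof.
move=> sp; pose q := p - \sum_(a < d) p.[a%:R] *: node_basis a.
have q0 : q = 0.
  apply: (@poly_eq0_nodes q d).
    rewrite (leq_trans (size_polyD _ _))// geq_max sp size_polyN.
    apply: (leq_trans (size_sum _ _ _)); apply/bigmax_leqP => a _.
    by rewrite (leq_trans (size_scale_leq _ _))// size_node_basis.
  move=> b; rewrite /q hornerD hornerN horner_sum (bigD1 b)//= big1 => [|a ab].
    by rewrite hornerZ node_basisE eqxx mulr1 addr0 subrr.
  by rewrite hornerZ node_basisE (negPf ab) mulr0.
have : q.[t] = 0 by rewrite q0 horner0.
rewrite /q hornerD hornerN horner_sum => /eqP; rewrite subr_eq0 => /eqP ->.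
by apply: eq_bigr => a _; rewrite hornerZ mulrC.
Qed.

Definition separately_poly d F : Prop := forall xi (j : 'I_n), exists2 p : {poly R},
  (size p <= d)%N & forall s, F (xi + s *: delta_mx 0 j) = p.[s].

(** The bound [d] being uniform, [F] is interpolated at the same nodes on all coordinate lines, and
    the variables are released one at a time: [trunc k] keeps the first [k] of them. *)
Lemma separately_polyfun d F : separately_poly d F -> polyfun F.
Proof.
pose trunc k xi : 'rV[R]_n := \row_(j < n) if (j < k)%N then xi 0 j else 0.
suff H k : (k <= n)%N -> forall F,
  separately_poly d F -> polyfun (fun xi => F (trunc k xi)).
  move=> sF; have := H n (leqnn n) F sF.
  by congr polyfun; apply/funext => xi; congr F; apply/rowP => j; rewrite mxE ltn_ord.
elim: k => [|k IH] kn {}F sF.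
  have -> : (fun xi => F (trunc 0 xi)) = (fun=> F 0).
    by apply/funext => xi; congr F; apply/rowP => j; rewrite !mxE.
  exact: polyfun_cst.
pose j := Ordinal kn.
have tE xi : trunc k.+1 xi = trunc k xi + xi 0 j *: delta_mx 0 j.
  apply/rowP => i; rewrite !mxE/= ltnS leq_eqVlt -(inj_eq val_inj)/=.
  have [ik|ik] := eqVneq (i : nat) k; last by rewrite mulr0 addr0.
  by rewrite ik ltnn add0r mulr1; congr (xi 0 _); apply: val_inj.
have -> : (fun xi => F (trunc k.+1 xi)) = (fun xi => \sum_(a < d)
    (node_basis a).[xi 0 j] * F (trunc k xi + a%:R *: delta_mx 0 j)).
  apply/funext => xi; rewrite tE; have [p sp pE] := sF (trunc k xi) j.
  by rewrite pE (poly_interpolation _ sp); apply: eq_bigr => a _; rewrite pE.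
apply: polyfun_sum => a; apply: polyfun_mul_horner.
(* The coefficients of the interpolation are translates of [F], which are separately polynomial with
   the same bound. *)
apply: (IH (ltnW kn) (fun xi => F (xi + a%:R *: delta_mx 0 j))) => xi i.
have [p sp pE] := sF (xi + a%:R *: delta_mx 0 j) i.
by exists p => // s; rewrite -pE addrAC.
Qed.

(** For fixed [xi], the polynomial in [t] with coefficients [G e xi], minus [F xi] times [t^d],
    vanishes at enough integers to be zero. Its coefficient of degree [d] identifies [F] with the
    component [G d], or with [0] if [d >= N]. *)
Lemma homogeneous_polyfun d F : polyfun F ->
  (forall (t : R) xi, F (t *: xi) = t ^+ d * F xi) -> form d F.
Proof.
move=> [N [G [fG FE]]] hF; have fGd := fG d.
suff -> : F = (fun xi => (if (d < N)%N then 1 else 0) * G d xi) by exact: formZ.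
apply/funext => xi.
pose p := \poly_(e < N) G e xi - F xi *: 'X^d.
have p0 : p = 0.
  apply: (@poly_eq0_nodes p (maxn N d.+1)).
    rewrite (leq_trans (size_polyD _ _))// size_polyN geq_max; apply/andP; split.
      by rewrite (leq_trans (size_poly _ _))// leq_maxl.
    by rewrite (leq_trans (size_scale_leq _ _))// size_polyXn leq_maxr.
  move=> i; rewrite /p hornerD hornerN hornerZ hornerXn horner_poly.
  apply/eqP; rewrite subr_eq0 mulrC -hF FE; apply/eqP; apply: eq_bigr => e _.
  by rewrite (formZ_hom _ _ (fG e)) mulrC.
have := congr1 (fun q : {poly R} => q`_d) p0.
rewrite coef0 /p coefB coefZ coefXn eqxx mulr1 coef_poly => /eqP.
by rewrite subr_eq0 => /eqP <-; case: ifP => _; rewrite ?mul1r ?mul0r.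
Qed.

(* The polarization formula for the symmetric tensor of a form of degree [d]. *)
Definition polar d W (i : {ffun 'I_d -> 'I_n}) : R :=
  (d`!)%:R^-1 * \sum_(S : {set 'I_d}) (-1) ^+ #|~: S| * W (\sum_(k in S) delta_mx 0 (i k)).

(** Expanding [W] at sums of basis vectors gives a sum over all maps [h] of ['I_d] to itself; the
    signed sum over [S] is an inclusion-exclusion that retains the surjective ones, that is, the
    permutations. The result is the symmetrization of [u]. *)
Lemma polar_form d W (u : {ffun 'I_d -> 'I_n} -> R) :
  (forall xi, W xi = \sum_i u i * monomial xi i) ->
  forall i, polar W i = (d`!)%:R^-1 * \sum_(s : 'S_d) u [ffun k => i (s k)].
Proof.
move=> Wu i; rewrite /polar; congr (_ * _).
have WS (S : {set 'I_d}) : W (\sum_(k in S) delta_mx 0 (i k)) =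
    \sum_(h : {ffun 'I_d -> 'I_d}) u [ffun k => i (h k)] * \prod_k (h k \in S)%:R.
  rewrite Wu.
  transitivity (\sum_(g : {ffun 'I_d -> 'I_n}) \sum_(h : {ffun 'I_d -> 'I_d})
     u g * \prod_k ((h k \in S)%:R * (i (h k) == g k)%:R)).
    apply: eq_bigr => g _; rewrite -mulr_sumr; congr (_ * _).
    (* A product of sums over [l] becomes a sum over the choices [h] of one summand in each
       factor. *)
    rewrite -(bigA_distr_bigA (fun k l => (l \in S)%:R * (i l == g k)%:R)) /monomial.
    apply: eq_bigr => k _; rewrite summxE big_mkcond/=; apply: eq_bigr => l _.
    by rewrite mxE eqxx/= eq_sym; case: ifP; rewrite ?mul1r ?mul0r.
  rewrite exchange_big/=; apply: eq_bigr => h _.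
  rewrite (bigD1 [ffun k => i (h k)])//= [X in _ + X]big1 ?addr0 => [|g gh].
    by congr (_ * _); apply: eq_bigr => k _; rewrite ffunE eqxx mulr1.
  have [k gk] : exists k, i (h k) != g k.
    apply/existsP; apply: contraR gh; rewrite negb_exists => /forallP gk.
    by apply/eqP/ffunP => k; have := gk k; rewrite negbK ffunE => /eqP.
  by rewrite (bigD1 k)//= (negPf gk) mulr0 mul0r mulr0.
under eq_bigr do rewrite WS mulr_sumr.
rewrite exchange_big/=.
have sgnE (h : {ffun 'I_d -> 'I_d}) :
    \sum_(S : {set 'I_d}) (-1) ^+ #|~: S| * \prod_k (h k \in S)%:R = (injectiveb h)%:R :> R.
  (* Once the term is a product over [l], the sum over [S] factors into the product over [l] of [1 -
     [l not in the image of h]]. *)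
  have E (S : {set 'I_d}) : (-1) ^+ #|~: S| * \prod_k (h k \in S)%:R =
      \prod_l (if l \in S then 1 else - (l \notin codom h)%:R) :> R.
    have [hS|hS] := boolP [forall k, h k \in S].
      rewrite [X in _ * X]big1 ?mulr1 => [|k _]; last by rewrite (forallP hS).
      rewrite (bigID (mem S))/= [X in _ = X * _]big1 ?mul1r => [|l lS]; last by rewrite lS.
      rewrite -prodr_const (eq_bigl (fun l => l \notin S)) => [|l]; last by rewrite inE.
      apply: eq_bigr => l lS; rewrite (negPf lS); case: (boolP (l \in codom h)) => //=.
      by move=> /codomP[k lk]; move: lS; rewrite lk (forallP hS).
    move: hS; rewrite negb_forall => /existsP[k kS].
    rewrite (bigD1 k)//= (negPf kS) mul0r mulr0 (bigD1 (h k))//= (negPf kS) codom_f/=.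
    by rewrite oppr0 mul0r.
  under eq_bigr do rewrite E.
  transitivity (\prod_l (1 + - (l \notin codom h)%:R) : R).
    by rewrite bigA_distr; apply: eq_bigl => S.
  have [/injectiveP hi|hi] := boolP (injectiveb h).
    by rewrite big1// => l _; rewrite (inj_card_onto hi)// ?card_ord//= oppr0 addr0.
  have [l lh] : exists l, l \notin codom h.
    apply/existsP; apply: contraR hi; rewrite negb_exists => /forallP hs.
    have /image_injP hin : #|[seq h k | k in 'I_d]| == #|'I_d|.
      by apply/eqP; apply: eq_card => l; rewrite inE; have := hs l; rewrite negbK.
    by apply/injectiveP => k l; exact: hin.
  by rewrite (bigD1 l)//= lh addrN mul0r.
under eq_bigr => h _.
  under eq_bigr do rewrite mulrCA.
  rewrite -mulr_sumr sgnE.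
  over.
rewrite (bigID (fun h : {ffun 'I_d -> 'I_d} => injectiveb h))/= [X in _ + X]big1
  ?addr0; last first.
  by move=> h /negPf ->; rewrite mulr0.
rewrite (reindex (fun s : 'S_d => val s)); last first.
  exists (fun h => insubd (1%g : 'S_d) h) => [s _|h hi]; first by rewrite valKd.
  by rewrite insubdK.
apply: eq_big => [s|s _]; first exact: (valP s).
by rewrite (valP s) mulr1; congr u; apply/ffunP => k; rewrite !ffunE pvalE.
Qed.

Definition symmetric_coef d (u : {ffun 'I_d -> 'I_n} -> R) : Prop :=
  forall (s : 'S_d) (i : {ffun 'I_d -> 'I_n}), u [ffun k => i (s k)] = u i.

Let fact_neq0 d : (d`!)%:R != 0 :> R.
Proof. by rewrite pnatr_eq0 -lt0n fact_gt0. Qed.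

Lemma polar_symmetric_form d W (u : {ffun 'I_d -> 'I_n} -> R) : symmetric_coef u ->
  (forall xi, W xi = \sum_i u i * monomial xi i) -> forall i, polar W i = u i.
Proof.
move=> su Wu i; rewrite (polar_form Wu) (eq_bigr (fun=> u i)) => [|s _]; last exact: su.
by rewrite sumr_const card_Sn -[u i *+ _]mulr_natl mulKf ?fact_neq0.
Qed.

Lemma symmetric_polar d W : symmetric_coef (@polar d W).
Proof.
move=> s i; rewrite /polar; congr (_ * _).
rewrite (reindex_inj (imset_inj (@perm_inj _ (s^-1)%g)))/=; apply: eq_bigr => S _.
have cS (A : {set 'I_d}) : #|~: A| = (d - #|A|)%N by rewrite cardsCs finset.setCK card_ord.
congr (_ * W _); first by rewrite !cS card_imset//; exact: perm_inj.
rewrite big_imset/=; last by move=> ? ? _ _; exact: perm_inj.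
by apply: eq_bigr => k _; rewrite ffunE permKV.
Qed.

Lemma monomial_perm d xi (s : 'S_d) (i : {ffun 'I_d -> 'I_n}) :
  monomial xi [ffun k => i (s k)] = monomial xi i.
Proof.
rewrite /monomial [RHS](reindex_inj (@perm_inj _ s))/=.
by apply: eq_bigr => k _; rewrite ffunE.
Qed.

Lemma sum_ffun_perm d (s : 'S_d) (F : {ffun 'I_d -> 'I_n} -> R) :
  \sum_(i : {ffun 'I_d -> 'I_n}) F [ffun k => i (s k)] = \sum_i F i.
Proof.
rewrite [RHS](reindex (fun i : {ffun 'I_d -> 'I_n} => [ffun k => i (s k)]))//.
by exists (fun i : {ffun 'I_d -> 'I_n} => [ffun k => i ((s^-1)%g k)]) => i _;
  apply/ffunP => k; rewrite !ffunE ?permK ?permKV.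
Qed.

Lemma form_polar d W : form d W -> forall xi, W xi = \sum_i @polar d W i * monomial xi i.
Proof.
move=> [u Wu] xi; under [RHS]eq_bigr do rewrite (polar_form Wu) -mulrA mulr_suml.
rewrite -mulr_sumr exchange_big/= (eq_bigr (fun=> W xi)) => [|s _].
  by rewrite sumr_const card_Sn -[W xi *+ _]mulr_natl mulKf ?fact_neq0.
rewrite Wu -(sum_ffun_perm s (fun i => u i * monomial xi i)).
by apply: eq_bigr => i _; rewrite monomial_perm.
Qed.

End forms.

(** * Kernel of the ray transform *)

Section inner_differentiation.
Context {R : realType} {n : nat}.
Implicit Types (x xi : 'rV[R]_n).

(** As a sum over the permutations of the arguments of one function [T], the symmetrization can be
    reindexed. *)
Lemma inner_diffE p (u : tensor_field R n p) (i : {ffun 'I_p.+1 -> 'I_n}) x :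
  let T (i : {ffun 'I_p.+1 -> 'I_n}) :=
    pderiv (i ord_max) (u [ffun k => i (widen_ord (leqnSn p) k)]) x in
  inner_diff u i x = (p.+1`!)%:R^-1 * \sum_(s : 'S_p.+1) T [ffun k => i (s k)].
Proof.
rewrite /inner_diff; congr (_ * _); apply: eq_bigr => s _; rewrite ffunE.
by congr (pderiv _ (u _) x); apply/ffunP => k; rewrite !ffunE.
Qed.

Lemma symmetric_inner_diff p (u : tensor_field R n p) : symmetric_field (inner_diff u).
Proof.
move=> t i; apply/funext => x; rewrite !inner_diffE; congr (_ * _).
rewrite [RHS](reindex_inj (mulIg t))/=; apply: eq_bigr => s _.
have -> // : [ffun k => [ffun k0 => i (t k0)] (s k)] = [ffun k => i ((s * t)%g k)].
by apply/ffunP => k; rewrite !ffunE permM.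
Qed.

Lemma smooth_inner_diff p (u : tensor_field R n p) :
  (forall i, smooth (u i)) -> forall i, smooth (inner_diff u i).
Proof.
move=> su i; rewrite /inner_diff; under eq_fun do rewrite mulr_sumr.
by apply: smooth_lin => s; exact: smooth_pderiv.
Qed.

Lemma schwartz_inner_diff p (u : tensor_field R n p) :
  (forall i, schwartz (u i)) -> forall i, schwartz (inner_diff u i).
Proof.
move=> su i; rewrite /inner_diff; under eq_fun do rewrite mulr_sumr.
by apply: schwartz_lin => s; exact: schwartz_pderiv.
Qed.

Lemma smooth_contract m (f : tensor_field R n m) xi :
  (forall i, smooth (f i)) -> smooth (contract f xi).
Proof.
move=> sf; have := smooth_lin (index_enum {ffun 'I_m -> 'I_n}) (monomial xi) sf.
by congr smooth; apply/funext => x; apply: eq_bigr => i _; rewrite mulrC.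
Qed.

Lemma pderiv_contract m (f : tensor_field R n m) xi (j : 'I_n) x :
  (forall i, smooth (f i)) ->
  pderiv j (contract f xi) x = \sum_i pderiv j (f i) x * monomial xi i.
Proof.
move=> sf; have := congr1 (fun F => F x)
  (pderivs_lin (index_enum {ffun 'I_m -> 'I_n}) (monomial xi) [:: j] sf).
rewrite /= => E; under [RHS]eq_bigr do rewrite mulrC.
rewrite -E; congr (pderiv j _ x); apply/funext => y; apply: eq_bigr => i _.
by rewrite mulrC.
Qed.

(** A product of coordinates of the single vector [xi] is symmetric in the indices, so the average
    over permutations disappears; the last index then gives the direction of differentiation. *)
Lemma contract_inner_diff p (u : tensor_field R n p) xi x :
  (forall i, smooth (u i)) ->
  contract (inner_diff u) xi x = dirderiv xi (contract u xi) x.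
Proof.
move=> su; pose T (j : 'I_n) (i : {ffun 'I_p -> 'I_n}) := pderiv j (u i) x.
pose T' (i : {ffun 'I_p.+1 -> 'I_n}) :=
  T (i ord_max) [ffun k => i (widen_ord (leqnSn p) k)].
transitivity (\sum_(i : {ffun 'I_p.+1 -> 'I_n}) T' i * monomial xi i).
  rewrite /contract; under eq_bigr do rewrite inner_diffE -mulrA mulr_suml.
  rewrite -mulr_sumr exchange_big/= (eq_bigr (fun=> \sum_i T' i * monomial xi i)).
    by rewrite sumr_const card_Sn -[(\sum_i _) *+ _]mulr_natl mulKf// pnatr_eq0 -lt0n
      fact_gt0.
  move=> s _; rewrite -[RHS](sum_ffun_perm s); apply: eq_bigr => i _.
  by rewrite monomial_perm.
pose S (j : 'I_n) (i : {ffun 'I_p -> 'I_n}) := T j i * (monomial xi i * xi 0 j).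
transitivity (\sum_(j < n) \sum_(i : {ffun 'I_p -> 'I_n}) S j i).
  by rewrite -(sum_ffun_recr S); apply: eq_bigr => i _; rewrite monomial_recr.
apply: eq_bigr => j _; rewrite pderiv_contract// mulr_sumr; apply: eq_bigr => i _.
by rewrite /S /T; ring.
Qed.

(** A symmetric field is the polarization of its form, so tensor identities can be checked on
    contractions. *)
Lemma contract_inj m (f g : tensor_field R n m) :
  symmetric_field f -> symmetric_field g ->
  (forall xi x, contract f xi x = contract g xi x) -> f = g.
Proof.
move=> sf sg fg; apply/funext => i; apply/funext => x.
have sfx : symmetric_coef (fun i => f i x) by move=> s i'; rewrite sf.
have sgx : symmetric_coef (fun i => g i x) by move=> s i'; rewrite sg.
rewrite -(polar_symmetric_form sfx (W := fun xi => contract f xi x))//.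
rewrite -(polar_symmetric_form sgx (W := fun xi => contract g xi x))//.
by congr polar; apply/funext => xi; exact: fg.
Qed.

Lemma contractZ m (f : tensor_field R n m) (c : R) xi x :
  contract f (c *: xi) x = c ^+ m * contract f xi x.
Proof.
rewrite /contract mulr_sumr; apply: eq_bigr => i _.
by rewrite -/(monomial (c *: xi) i) monomialZ mulrCA.
Qed.

(** [G] is constant on lines of direction [xi] and tends to 0 along them. This uniqueness for the
    transport equation compares potentials without computing integrals. *)
Lemma schwartz_flat_eq0 (G : 'rV[R]_n -> R) xi : xi != 0 -> schwartz G ->
  (forall x, is_derive x xi G 0) -> forall x, G x = 0.
Proof.
move=> xi0 sG dG x.
have cst t : G (x + t *: xi) = G x.
  have [c _] := MVT0 t (fun t => (is_derive_line G x xi t _).1 (dG _)).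
  by rewrite scale0r addr0 mul0r => /eqP; rewrite subr_eq0 => /eqP.
have tG : tame (fun t : R => G (x + t *: xi)).
  by apply: tame_line => //; [exact: schwartz_continuous|exact: schwartz_rapid].
have l1 := tame_cvgy tG.
have l2 : (fun t : R => G (x + t *: xi)) t @[t --> +oo] --> G x.
  by under eq_fun do rewrite cst; exact: cvg_cst.
by rewrite -(cvg_lim (@Rhausdorff R) l1) (cvg_lim (@Rhausdorff R) l2).
Qed.

End inner_differentiation.

Section ray_transform_kernel.
Context {R : realType} {n : nat}.
Implicit Types (x xi : 'rV[R]_n).
Variables l0 l1 : 'I_n.
Hypothesis l01 : l0 != l1.

Let delta_neq0 (j : 'I_n) : delta_mx 0 j != 0 :> 'rV[R]_n.
Proof. by apply/eqP => /rowP/(_ j)/eqP; rewrite !mxE !eqxx oner_eq0. Qed.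

(** Only the zero polynomial has degree less than [0], so the combination with the single
    coefficient [1] is admissible and kills the potential itself, of which [f] is a derivative. *)
Lemma null_scalar (f : tensor_field R n 0) : (forall i, schwartz (f i)) ->
  (forall xi, xi != 0 -> null_lines xi (contract f xi)) -> f = fun _ _ => 0.
Proof.
move=> sf zf; have P0 x : potential f (delta_mx 0 l0) x = 0.
  have h : (delta_mx 0 l0 : 'rV[R]_n) 0 l0 != 0 by rewrite mxE !eqxx oner_eq0.
  have := @potential_divided_difference R n 0 f sf zf l1 l0 (delta_mx 0 l0) 1
    (fun=> 1) (fun=> 0) l01 h.
  move=> /(_ _ x); rewrite big_ord1 mul1r scale0r addr0; apply => q.
  by rewrite leqn0 size_poly_eq0 => /eqP ->; rewrite big_ord1 horner0 mulr0.
apply/funext => i; apply/funext => x.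
have := potential_is_derive sf zf x (delta_neq0 l0).
have -> : potential f (delta_mx 0 l0) = cst 0 by apply/funext => y; exact: P0.
move=> d; have : contract f (delta_mx 0 l0) x = 0.
  by rewrite -(@derive_val _ _ _ _ _ _ _ d) derive_cst.
rewrite /contract (big_pred1 i) => [|i']; last first.
  by apply/esym/eqP/ffunP => -[].
by rewrite big_ord0 mulr1.
Qed.

(** * Tensor fields of positive degree *)

Section positive_degree.
Variables (p : nat) (f : tensor_field R n p.+1).
Hypothesis sf : forall i, schwartz (f i).
Hypothesis zf : forall xi, xi != 0 -> null_lines xi (contract f xi).

Let V := potential f.
Let sV xi : xi != 0 -> schwartz (V xi) := schwartz_potential sf zf (xi := xi).

(** Both sides are Schwartz with the same derivative along [xi]. This covers [c < 0], where a
    substitution in the integral would reverse the half-line. *)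
Lemma potentialZ (c : R) xi x : c != 0 -> xi != 0 -> V (c *: xi) x = c ^+ p * V xi x.
Proof.
move=> c0 xi0; have cxi0 : c *: xi != 0 by rewrite scaler_eq0 negb_or c0.
pose G y := \sum_(b : bool) (if b then 1 else - c ^+ p) * V (if b then c *: xi else xi) y.
have sG : schwartz G by apply: schwartz_lin => -[]; exact: sV.
have GE y : G y = V (c *: xi) y - c ^+ p * V xi y by rewrite /G big_bool/= mul1r mulNr.
have dG y : is_derive y xi G 0.
  have d1 := is_derive_scale c^-1 (potential_is_derive sf zf y cxi0).
  rewrite scalerA mulVf// scale1r contractZ in d1.
  have d2 := is_deriveZ (c ^+ p) (potential_is_derive sf zf y xi0).
  have -> : G = V (c *: xi) - (c ^+ p \*: V xi) by apply/funext => z; rewrite GE.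
  have := is_deriveB d1 d2; move=> H; apply: is_derive_eq H _.
  by rewrite exprS -mulrA mulKf// subrr.
have := schwartz_flat_eq0 xi0 sG dG x.
by rewrite GE => /eqP; rewrite subr_eq0 => /eqP.
Qed.

(** A form of degree 0 is a constant. The differences [V (zeta + e_j) - V zeta] vanish, which
    compares the basis vectors; a general direction follows from uniqueness for the transport
    equation, as [f . xi] is linear in [xi]. *)
Lemma potential_deg0 xi x : p = 0 -> xi != 0 -> V xi x = V (delta_mx 0 l0) x.
Proof.
move=> p0 xi0.
have step (j l : 'I_n) (zeta y : 'rV[R]_n) : l != j -> zeta 0 l != 0 ->
    V (zeta + delta_mx 0 j) y = V zeta y.
  move=> lj zl.
  have := @potential_divided_difference R n p.+1 f sf zf j l zeta 2
    (fun i => if i == ord0 then 1 else -1) (fun i => if i == ord0 then 1 else 0) lj zl.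
  move=> /(_ _ y); rewrite !big_ord_recl big_ord0/= scale1r scale0r !addr0 mul1r mulN1r.
  move=> H; apply/eqP; rewrite -subr_eq0; apply/eqP; apply: H => q.
  rewrite p0 => /size1_polyC ->; rewrite !big_ord_recl big_ord0/= !hornerC; ring.
have Ve (j : 'I_n) (y : 'rV[R]_n) : V (delta_mx 0 j) y = V (delta_mx 0 l0) y.
  have [->//|jl0] := eqVneq j l0.
  have e1 (k : 'I_n) : (delta_mx 0 k : 'rV[R]_n) 0 k != 0 by rewrite mxE !eqxx oner_eq0.
  have l0j : l0 != j by rewrite eq_sym.
  (* Both potentials equal that of [e_j + e_l0]. *)
  rewrite -(step l0 j (delta_mx 0 j))// -(step j l0 (delta_mx 0 l0))//.
  by rewrite addrC.
pose G y := \sum_(b : bool) (if b then 1 else - 1) * V (if b then xi else delta_mx 0 l0) y.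
have sG : schwartz G by apply: schwartz_lin => -[]; exact: sV.
have GE y : G y = V xi y - V (delta_mx 0 l0) y by rewrite /G big_bool/= mul1r mulN1r.
have dG y : is_derive y xi G 0.
  have d1 := potential_is_derive sf zf y xi0.
  have d2 := smooth_dirderiv xi y (schwartz_smooth (sV (delta_neq0 l0))).
  have -> : G = V xi - V (delta_mx 0 l0) by apply/funext => z; rewrite GE.
  have := is_deriveB d1 d2; move=> H; apply: is_derive_eq H _.
  apply/eqP; rewrite subr_eq0; apply/eqP.
  rewrite /dirderiv (eq_bigr (fun j => xi 0 j * contract f (delta_mx 0 j) y)); last first.
    move=> j _; congr (_ * _); have <- : V (delta_mx 0 j) = V (delta_mx 0 l0).
      by apply/funext => z; exact: Ve.
    exact: pderiv_eq (potential_is_derive sf zf y (delta_neq0 j)).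
  rewrite /contract; under [RHS]eq_bigr do rewrite mulr_sumr.
  rewrite exchange_big/=; apply: eq_bigr => i _.
  have prod1 (zeta : 'rV[R]_n) : \prod_(k < p.+1) zeta 0 (i k) = zeta 0 (i ord0).
    by rewrite big_ord_recl big1 ?mulr1// => -[k kp] _; exfalso; move: kp; rewrite p0.
  rewrite prod1; under eq_bigr do rewrite prod1.
  rewrite (bigD1 (i ord0))//= big1 => [|j jl].
    by rewrite mxE !eqxx mulr1 addr0 mulrC.
  by rewrite mxE eqxx/= eq_sym (negPf jl) !mulr0.
have := schwartz_flat_eq0 xi0 sG dG x.
by rewrite GE => /eqP; rewrite subr_eq0 => /eqP.
Qed.

(** At [xi = 0] the value is the one forced by homogeneity of degree [p]. The integral gives 0
    there, which is wrong for [p = 0], where the form is a constant. *)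
Let W x xi := if xi == 0 then (if p is 0 then V (delta_mx 0 l0) x else 0) else V xi x.

Let W_hom x (c : R) xi : W x (c *: xi) = c ^+ p * W x xi.
Proof.
have [->|c0] := eqVneq c 0.
  rewrite scale0r /W eqxx; case: ifP => xi0.
    by case: {+}p => [|q]; rewrite ?mul1r ?mulr0.
  have := @potential_deg0 xi x; rewrite xi0 /=.
  by case: {+}p V => [|q] V' E; rewrite ?expr0 ?mul1r ?(E erefl isT)// expr0n mul0r.
rewrite /W scaler_eq0 (negPf c0)/=; case: ifP => [xi0|/negbT xi0].
  by case: {+}p => [|q]; rewrite ?mul1r ?mulr0.
exact: potentialZ.
Qed.

Let W_line x : separately_poly p.+1 (W x).
Proof.
move=> xi j; have [/existsP[l /andP[lj xil]]|H] :=
  boolP [exists l, (l != j) && (xi 0 l != 0)].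
  have WE t : W x (xi + t *: delta_mx 0 j) = V (xi + t *: delta_mx 0 j) x.
    rewrite /W; case: ifP => // /eqP/rowP/(_ l); rewrite !mxE eqxx (negPf lj) mulr0 addr0.
    by move=> h; rewrite h eqxx in xil.
  exists (\sum_(a < p.+1) V (xi + a%:R *: delta_mx 0 j) x *: node_basis a).
    apply: (leq_trans (size_sum _ _ _)); apply/bigmax_leqP => a _.
    by rewrite (leq_trans (size_scale_leq _ _))// size_node_basis.
  move=> t; rewrite WE horner_sum.
  (* The interpolation error at [t], as a functional supported on the [p + 1] nodes and on [t]
     itself. *)
  pose c (i : 'I_p.+2) : R := if unlift ord_max i is Some a then (node_basis a).[t] else -1.
  pose s (i : 'I_p.+2) : R := if unlift ord_max i is Some a then a%:R else t.
  have lift (a : 'I_p.+1) : unlift ord_max (widen_ord (leqnSn p.+1) a) = Some a.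
    rewrite (_ : widen_ord _ a = lift ord_max a) ?liftK//.
    by apply: val_inj; rewrite /= /bump leqNgt ltn_ord.
  have sumE (F : R -> R) : \sum_i c i * F (s i) = \sum_(a < p.+1) (node_basis a).[t] *
    F a%:R - F t.
    rewrite big_ord_recr/= {2}/c {2}/s unlift_none mulN1r; congr (_ - _).
    by apply: eq_bigr => a _; rewrite /c /s lift.
  have := @potential_divided_difference R n p.+1 f sf zf j l xi p.+2 c s lj xil.
  move=> /(_ _ x); rewrite (sumE (fun t => potential f (xi + t *: delta_mx 0 j) x)) => H.
  apply/eqP; rewrite -subr_eq0 -oppr_eq0 opprB; apply/eqP.
  rewrite -[RHS]H; last first.
    by move=> q sq; rewrite (sumE (fun t => q.[t])) -poly_interpolation// subrr.
  by congr (_ - _); apply: eq_bigr => a _; rewrite hornerZ mulrC.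
(* [xi] is now a multiple of [e_j] and spans no plane with it; homogeneity gives the polynomial
   [(t + xi_j)^p] up to a constant. *)
have xiE : xi = xi 0 j *: delta_mx 0 j.
  apply/rowP => l; rewrite !mxE eqxx/=; have [->|lj] := eqVneq l j; first by rewrite mulr1.
  rewrite mulr0; apply/eqP; apply: contraR H => xil; apply/existsP; exists l.
  by rewrite lj.
exists (W x (delta_mx 0 j) *: ('X + (xi 0 j)%:P) ^+ p).
  rewrite (leq_trans (size_scale_leq _ _))// (leq_trans (size_exp_leq _ _))//.
  by rewrite size_XaddC mul1n.
move=> t; rewrite {1}xiE -scalerDl W_hom hornerZ horner_exp hornerD hornerX hornerC.
by rewrite mulrC [t + _]addrC.
Qed.

Lemma null_lines_inner_diff : symmetric_field f ->
  exists2 v : tensor_field R n p, schwartz_sym v & f = inner_diff v.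
Proof.
move=> symf; pose v : tensor_field R n p := fun i x => polar (W x) i.
have formW x : form p (W x).
  by apply: homogeneous_polyfun; [exact: separately_polyfun (W_line x)|exact: W_hom].
have vW xi x : contract v xi x = W x xi by rewrite (form_polar (formW x)).
have sW xi : schwartz (W ^~ xi).
  have s0 : schwartz (fun _ : 'rV[R]_n => 0 : R).
    have := schwartz_lin [::] (fun _ : unit => 0) (fun=> sV (delta_neq0 l0)).
    by under eq_fun do rewrite big_nil.
  rewrite /W; have [_|xi0] := eqVneq xi 0; last exact: sV.
  by case: {+}p => [|q] //; exact: sV.
have sv i : schwartz (v i).
  (* A component of [v] is a combination, with constant coefficients, of values of [W] at fixed
     directions. *)
  rewrite /v /polar; under eq_fun do rewrite mulr_sumr.
  under eq_fun do under eq_bigr do rewrite mulrA.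
  exact: schwartz_lin.
have svm i : smooth (v i) by exact: schwartz_smooth.
have symv : symmetric_field v.
  by move=> s i; apply/funext => x; exact: (@symmetric_polar R n p (W x) s i).
exists v; first exact: (conj symv sv).
apply: (contract_inj symf (symmetric_inner_diff v)) => xi x.
rewrite (contract_inner_diff xi x svm).
(* At [xi = 0] both sides vanish, having degree [p + 1] in [xi]. *)
have [->|xi0] := eqVneq xi 0.
  rewrite /dirderiv [RHS]big1 => [|j _]; last by rewrite mxE mul0r.
  by rewrite /contract big1// => i _; rewrite big_ord_recl mxE mul0r mulr0.
have -> : contract v xi = V xi by apply/funext => y; rewrite vW /W (negPf xi0).
have d1 := potential_is_derive sf zf x xi0.
have d2 := smooth_dirderiv xi x (schwartz_smooth (sV xi0)).
by rewrite -(@derive_val _ _ _ _ _ _ _ d2) (@derive_val _ _ _ _ _ _ _ d1).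
Qed.

End positive_degree.
End ray_transform_kernel.

(** * Moments *)

Section rapid_line_functions.
Context {R : realType}.
Implicit Types (g h : R -> R) (t : R).

Definition rapid1 g : Prop :=
  continuous g /\ forall N, exists C, forall t, `|g t| <= C * lorentz t ^+ N.

Lemma rapid1_tame q g : rapid1 g -> tame (fun t => t ^+ q * g t).
Proof.
move=> [cg gN]; split.
  by move=> t; apply: cvgM; [exact: exprn_continuous|exact: cg].
have [C gC] := gN q.+1; exists C => t; rewrite normrM normrX.
have l0 := lorentz_gt0 t; have t2 := sqr_ge0 t.
have tl : `|t| * lorentz t <= 1.
  rewrite /lorentz ler_pdivrMr ?mul1r; last by lra.
  by rewrite -real_normK ?num_real//; have := sqr_ge0 (`|t| - 1); rewrite sqrrB1;
    have := normr_ge0 t; lra.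
have tq : `|t| ^+ q * lorentz t ^+ q <= 1.
  by rewrite -exprMn exprn_ile1// mulr_ge0// ltW.
apply: (@le_trans _ _ (`|t| ^+ q * (C * lorentz t ^+ q.+1))).
  by rewrite ler_wpM2l// exprn_ge0.
have C0 : 0 <= C.
  have := le_trans (normr_ge0 _) (gC t).
  by rewrite pmulr_lge0// exprn_gt0.
rewrite mulrCA ler_wpM2l// exprSr mulrA ler_piMl//.
exact: ltW.
Qed.

Lemma rapid1_tame0 g : rapid1 g -> tame g.
Proof. by move=> /(@rapid1_tame 0); under eq_fun do rewrite expr0 mul1r. Qed.

(** For [t >= 0], [g t] is minus the integral of [h] over the half-line from [t]. As [(s + t)^2] is
    at least [s^2] and [t^2], one of the [N + 1] Lorentzian factors is spent on the integral in [s]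
    and [N] remain in [t]; negative [t] follow by reflection. *)
Lemma rapid1_primitive g h : rapid1 h -> (forall t, is_derive t (1 : R) g (h t)) ->
  g t @[t --> +oo] --> (0 : R) -> g t @[t --> -oo] --> (0 : R) -> rapid1 g.
Proof.
move=> rh dg gy gNy; have th := rapid1_tame0 rh.
have cg : continuous g.
  move=> t; apply/differentiable_continuous/derivable1_diffP.
  exact: (@ex_derive _ _ _ _ _ _ _ (dg t)).
split => // N; have [_ /(_ N.+1)[C hC]] := rh.
have C0 : 0 <= C.
  have := le_trans (normr_ge0 _) (hC 0).
  by rewrite pmulr_lge0// exprn_gt0// lorentz_gt0.
have key (G H : R -> R) t : (forall t, is_derive t (1 : R) G (H t)) -> continuous G ->
    tame H -> G t @[t --> +oo] --> (0 : R) ->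
    (forall t, `|H t| <= C * lorentz t ^+ N.+1) -> 0 <= t ->
    `|G t| <= C * lorentz t ^+ N * (pi / 2).
  move=> dG cG tH Gy HC t0.
  have tHt : tame (fun s => H (1 * s + t)) by apply: tame_affine; rewrite ?oner_eq0.
  have dGt s : is_derive s (1 : R) (fun s => G (1 * s + t)) (H (1 * s + t)).
    have ds : is_derive s (1 : R) (fun s : R => 1 * s + t) 1.
      have := is_deriveD (is_deriveZ (1 : R) (is_derive_id s (1 : R))) (is_derive_cst t
        s (1 : R)).
      by move=> K; apply: is_derive_eq K _; rewrite addr0 scale1r.
    have := @is_derive1_comp _ G (fun s => 1 * s + t) s _ _ (dG (1 * s + t)) ds.
    by rewrite mulr1.
  have E : Ihalf (fun s => H (1 * s + t)) = 0 - G (1 * 0 + t).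
    apply: (@Ihalf_FTC _ _ (fun s => G (1 * s + t))) => //.
    - move=> s; apply: (@continuous_comp R R R (fun s => 1 * s + t) G); last exact: cG.
      by apply: cvgD; [apply: cvgM; [exact: cvg_cst|exact: cvg_id]|exact: cvg_cst].
    - apply: (@cvg_comp _ _ _ (fun s => 1 * s + t) G _ +oo) => //.
      by apply/cvgryPge => A; near=> s; rewrite mul1r -lerBlDr.
  have -> : G t = - Ihalf (fun s => H (1 * s + t)) by rewrite E sub0r opprK mulr0 add0r.
  rewrite normrN; apply: normr_Ihalf => // s s0.
  rewrite (le_trans (HC _))// -mulrA ler_wpM2l// exprSr mul1r.
  have st : 0 <= s * t by exact: mulr_ge0.
  have s2 := sqr_ge0 s; have t2 := sqr_ge0 t.
  have e : (s + t) ^+ 2 = s ^+ 2 + t ^+ 2 + 2 * (s * t) by ring.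
  have le_lor a : 0 <= a ^+ 2 <= (s + t) ^+ 2 -> lorentz (s + t) <= lorentz a.
    by move=> /andP[a0 ale]; rewrite lef_pV2 ?posrE; lra.
  apply: ler_pM; rewrite ?exprn_ge0 ?lorentz_ge0//.
    by rewrite lerXn2r ?nnegrE ?lorentz_ge0// le_lor//; apply/andP; split; lra.
  by rewrite le_lor//; apply/andP; split; lra.
exists (C * (pi / 2)) => t; rewrite mulrAC.
have [t0|t0] := leP 0 t; first exact: (key g h).
have -> : g t = (fun t => g (- t)) (- t) by rewrite opprK.
have -> : lorentz t = lorentz (- t) by rewrite /lorentz sqrrN.
apply: (key (fun t => g (- t)) (fun t => - h (- t))).
- move=> s; have := @is_derive1_comp _ g -%R s _ _ (dg (- s)) (is_deriveNid s (1 : R)).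
  by move=> K; apply: is_derive_eq K _; rewrite mulrN1.
- by move=> s; apply: (@continuous_comp R R R -%R g); [exact: opp_continuous|exact: cg].
- have := tame_cst_mul (-1) (tameN th).
  by under eq_fun do rewrite mulN1r.
- exact/cvgNy_compNP.
- by move=> s; rewrite normrN (le_trans (hC _))// /lorentz sqrrN.
- by rewrite oppr_ge0 ltW.
Unshelve. all: by end_near. Qed.

Lemma rapid1_parts q g h : rapid1 g -> rapid1 h ->
  (forall t, is_derive t (1 : R) g (h t)) ->
  Iline (fun t => t ^+ q.+1 * h t) = - (q.+1%:R * Iline (fun t => t ^+ q * g t)).
Proof.
move=> rg rh dg; have t1 := rapid1_tame q.+1 rh; have t2 := rapid1_tame q rg.
have t3 := rapid1_tame q.+1 rg; have t4 := tame_cst_mul q.+1%:R t2.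
apply/eqP; rewrite -addr_eq0 -IlineZ// -IlineD//; apply/eqP.
rewrite -[RHS]subr0; apply: (@Iline_FTC _ _ (fun t => t ^+ q.+1 * g t) 0 0).
- exact: tameD.
- move=> t; have d1 : is_derive t (1 : R) (fun t : R => t ^+ q.+1) (q.+1%:R * t ^+ q).
    split; first exact: exprn_derivable.
    by rewrite exp_derive /GRing.scale/= mulr1.
  have := is_deriveM d1 (dg t).
  by move=> K; apply: is_derive_eq K _; rewrite /GRing.scale/=; ring.
- exact: tame_cvgy.
- exact: tame_cvgNy.
Qed.

Lemma rapid1_total g h : rapid1 g -> rapid1 h ->
  (forall t, is_derive t (1 : R) g (h t)) -> Iline h = 0.
Proof.
move=> /rapid1_tame0 tg /rapid1_tame0 th dg; rewrite -[RHS]subr0.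
by apply: (@Iline_FTC _ _ g 0 0) => //; [exact: tame_cvgy|exact: tame_cvgNy].
Qed.

(* [g l] plays the role of the [l]-th derivative of [g 0]. *)
Lemma rapid1_moments k (g : nat -> R -> R) : rapid1 (g k.+1) ->
  (forall l, (l <= k)%N -> forall t, is_derive t (1 : R) (g l) (g l.+1 t)) ->
  (forall l, (l <= k)%N -> g l t @[t --> +oo] --> (0 : R)) ->
  (forall l, (l <= k)%N -> g l t @[t --> -oo] --> (0 : R)) ->
  forall q, (q <= k)%N -> Iline (fun t => t ^+ q * g k.+1 t) = 0.
Proof.
move=> rk dg gy gNy.
(* Rapid decrease descends from [g k.+1], each function being a primitive of the next that vanishes
   at both ends; the induction is on the distance to [k.+1]. *)
have rg l : (l <= k.+1)%N -> rapid1 (g l).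
  move=> lk; have -> : l = (k.+1 - (k.+1 - l))%N by rewrite subKn.
  elim: (k.+1 - l)%N => [|i IH]; first by rewrite subn0.
  have [ki|ik] := leqP k.+1 i.
    move: IH; rewrite (_ : (k.+1 - i)%N = 0%N); last by apply/eqP; rewrite subn_eq0.
    by rewrite (_ : (k.+1 - i.+1)%N = 0%N)//; apply/eqP; rewrite subn_eq0 leqW.
  move: IH; rewrite subSS subSn// => IH.
  have h := leq_subr i k.
  by apply: (rapid1_primitive IH); [exact: dg|exact: gy|exact: gNy].
(* Each integration by parts lowers [q] and [l] together, leaving the integral of a derivative at
   [q = 0]. *)
suff H q : forall l, (q <= l)%N -> (l <= k)%N -> Iline (fun t => t ^+ q * g l.+1 t) = 0.
  by move=> q qk; exact: H.
elim: q => [|q IH] l ql lk.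
  under eq_fun do rewrite expr0 mul1r.
  by apply: (@rapid1_total (g l)); [exact/rg/leqW|exact: rg|exact: dg].
case: l ql lk => [//|l] ql lk.
rewrite (rapid1_parts q (rg _ (leqW lk)) (rg l.+2 lk) (dg _ lk)).
by rewrite IH ?mulr0 ?oppr0// ltnW.
Qed.

End rapid_line_functions.

(** * Moments of tensor fields *)

Section moments.
Context {R : realType} {n : nat}.
Implicit Types (x xi : 'rV[R]_n).

Lemma rapid1_line (G : 'rV[R]_n -> R) x xi : xi != 0 -> schwartz G ->
  rapid1 (fun t : R => G (x + t *: xi)).
Proof.
move=> xi0 sG; split; first by apply: continuous_line; exact: schwartz_continuous.
move=> N; have [K K0 hK] := bracket_line xi0.
have [C C0 GC] := rapid_bound N (schwartz_rapid sG).
exists (C * (K * bracket x) ^+ N) => t; rewrite (le_trans (GC _))// -mulrA ler_wpM2l//.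
have b0 := bracket_gt0 (x + t *: xi); have t2 := sqr_ge0 t.
have h : (bracket (x + t *: xi))^-1 <= K * bracket x * lorentz t.
  rewrite /lorentz ler_pdivlMr; last by lra.
  by rewrite mulrC ler_pdivrMr.
rewrite -exprVn -exprMn lerXn2r ?nnegrE ?invr_ge0 ?(ltW b0)//.
by rewrite (le_trans _ h)// invr_ge0 ltW.
Qed.

Lemma moment_transformE q m (f : tensor_field R n m) x xi :
  moment_transform q f x xi = Iline (fun t => t ^+ q * contract f xi (x + t *: xi)).
Proof. by []. Qed.

Lemma enorm1_dotr xi : enorm xi = 1 -> dotr xi xi = 1.
Proof.
by move=> h; have := sqr_sqrtr (dotr_sqr_ge0 xi); rewrite -/(enorm xi) h expr1n => <-.
Qed.

Lemma enorm1_neq0 xi : enorm xi = 1 -> xi != 0.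
Proof.
move=> /enorm1_dotr h; apply/eqP => xi0; move: h; rewrite xi0 /dotr big1.
  by move=> /eqP; rewrite eq_sym oner_eq0.
by move=> i _; rewrite mxE mul0r.
Qed.

(* Every line is a reparametrization of one in [tangent_sphere]. *)
Lemma kernel_null_lines m (f : tensor_field R n m) : (forall i, schwartz (f i)) ->
  (forall p, tangent_sphere p -> moment_transform 0 f p.1 p.2 = 0) ->
  forall xi, xi != 0 -> null_lines xi (contract f xi).
Proof.
move=> sf If xi xi0; have sc := schwartz_contract xi sf.
apply/null_linesP => // y; set r := enorm xi.
have d0 := dotr_gt0 xi0.
have r0 : 0 < r by rewrite sqrtr_gt0.
have r2 : r * r = dotr xi xi by rewrite -expr2 sqr_sqrtr// ltW.
pose u := r^-1 *: xi; have rn0 := lt0r_neq0 r0.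
have xiE : xi = r *: u by rewrite scalerA mulfV// scale1r.
have u1 : dotr u u = 1.
  by rewrite dotrZl dotrC dotrZl -r2; field.
have u0 : u != 0 by rewrite scaler_eq0 negb_or xi0 invr_eq0 rn0.
(* [x] is the foot of the perpendicular from the origin to the line, and [b] the parameter of [y] on
   it. *)
pose b := dotr y u; pose x := y - b *: u.
have xu : tangent_sphere (x, u).
  split=> /=; first by rewrite /enorm u1 sqrtr1.
  by rewrite /x dotrDl dotrNl dotrZl u1 mulr1 subrr.
have := If _ xu; rewrite moment_transformE /=.
under eq_fun do rewrite expr0 mul1r; move=> I0.
have su := schwartz_contract u sf.
have tu : tame (fun t : R => contract f u (x + t *: u)).
  by apply: tame_line => //; [exact: schwartz_continuous|exact: schwartz_rapid].
have E : (fun t : R => contract f xi (y + t *: xi)) =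
    (fun t => r ^+ m * contract f u (x + (r * t + b) *: u)).
  apply/funext => t; rewrite {1}xiE contractZ; congr (_ * contract _ _ _).
  by rewrite /x {1}xiE scalerA scalerDl [r * t]mulrC [X in _ = _ + X]addrC addrA subrK.
rewrite E IlineZ; last exact: (@tame_affine R r b _ rn0 tu).
by rewrite (@Iline_affine R r b _ rn0 tu) I0 !mulr0.
Qed.

Lemma moment_inner_diff q p (v : tensor_field R n p) x xi : xi != 0 ->
  (forall i, schwartz (v i)) ->
  moment_transform q.+1 (inner_diff v) x xi = - (q.+1%:R * moment_transform q v x xi).
Proof.
move=> xi0 sv; rewrite !moment_transformE; apply: rapid1_parts.
- by apply: rapid1_line => //; exact: schwartz_contract.
- by apply: rapid1_line => //; apply: schwartz_contract; exact: schwartz_inner_diff.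
- move=> t; have svm i : smooth (v i) by exact: schwartz_smooth.
  by rewrite (contract_inner_diff xi _ svm); apply: smooth_line; exact: smooth_contract.
Qed.

Lemma moment_cast q m m' (e : m = m') (u : tensor_field R n m) x xi :
  moment_transform q (cast_field e u) x xi = moment_transform q u x xi.
Proof.
case: _ / e; congr moment_transform; apply/funext => i; rewrite /cast_field.
by congr u; apply/ffunP => k; rewrite ffunE cast_ord_id.
Qed.

Lemma cast_field_id m (e : m = m) (u : tensor_field R n m) : cast_field e u = u.
Proof.
apply/funext => i; rewrite /cast_field.
by congr u; apply/ffunP => k; rewrite ffunE cast_ord_id.
Qed.

Lemma inner_diff0 p : inner_diff ((fun _ _ => 0) : tensor_field R n p) = fun _ _ => 0.
Proof.
apply/funext => i; apply/funext => x; rewrite /inner_diff big1 ?mulr0// => s _.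
exact: derive_cst.
Qed.

(** The rank [p] is existential, with an equation, so that the inductive step can eliminate the
    cast. The induction lowers [k] and [m] together; the first alternative arises when [m] reaches
    [0] with [k]. *)
Lemma moment_kernel_exact (l0 l1 : 'I_n) : l0 != l1 ->
  forall k m (f : tensor_field R n m),
    (k <= m)%N -> schwartz_sym f -> in_moment_kernel k f ->
  (k = m /\ f = fun _ _ => 0) \/
  exists p (e : (k.+1 + p)%N = m) (v : tensor_field R n p),
    schwartz_sym v /\ f = cast_field e (inner_diff_iter k.+1 v).
Proof.
move=> l01; elim=> [|k IH] m f km [symf sf] If.
  have zf := kernel_null_lines sf (If 0%N (leqnn _)).
  case: m f {km If} symf sf zf => [|p] f symf sf zf.
    by left; split => //; exact: (null_scalar l01 sf zf).
  have [v sv fv] := null_lines_inner_diff l0 sf zf symf.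
  by right; exists p, erefl, v; split => //; rewrite cast_field_id.
have zf := kernel_null_lines sf (If 0%N (leq0n _)).
case: m f km If symf sf zf => [//|m] f km If symf sf zf.
have [v [symv sv] fv] := null_lines_inner_diff l0 sf zf symf.
have Iv : in_moment_kernel k v.
  move=> q qk [x xi] xxi /=; have := If q.+1 qk _ xxi.
  rewrite fv moment_inner_diff//=; last by case: xxi => /= /enorm1_neq0.
  by move=> /eqP; rewrite oppr_eq0 mulf_eq0 pnatr_eq0/= => /eqP.
have [[km' v0]|[p [e [w [sw vw]]]]] := IH m v km (conj symv sv) Iv.
  by left; split; [rewrite km'|rewrite fv v0 inner_diff0].
right; destruct e.
(* The rank equation now holds by computation, as [inner_diff_iter] unfolds one step. *)
exists p, erefl, w; split => //.
by rewrite cast_field_id fv vw cast_field_id.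
Qed.

Lemma at_infty_filter : Filter (@at_infty R n).
Proof.
apply: filter_from_filter; first by exists 0.
move=> M N _ _; exists (Num.max M N) => // x /=.
by rewrite gt_max => /andP[].
Qed.

Lemma schwartz_vanishes (G : 'rV[R]_n -> R) : schwartz G ->
  G x @[x --> at_infty] --> (0 : R).
Proof.
move=> sG; have FF := at_infty_filter.
have [C C0 GC] := rapid_bound 1 (schwartz_rapid sG).
apply/cvgr0Pnorm_le => e e0; exists (C / e) => // x /= xM.
rewrite (le_trans (GC x))// expr1 ler_pdivrMr ?bracket_gt0// -ler_pdivrMl// mulrC.
have n0 : 0 <= enorm x by exact: sqrtr_ge0.
have n2 : enorm x ^+ 2 = dotr x x by rewrite sqr_sqrtr// dotr_sqr_ge0.
have := sqr_ge0 (enorm x - 1); rewrite sqrrB1 /bracket -n2 => h.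
by rewrite (le_trans (ltW xM))//; lra.
Qed.

Lemma schwartz_inner_diff_iter l p (v : tensor_field R n p) :
  (forall i, schwartz (v i)) -> forall i, schwartz (inner_diff_iter l v i).
Proof. by move=> sv; elim: l => [|l IH] //=; exact: schwartz_inner_diff. Qed.

Lemma smooth_inner_diff_iter l p (v : tensor_field R n p) :
  (forall i, smooth (v i)) -> forall i, smooth (inner_diff_iter l v i).
Proof. by move=> sv; elim: l => [|l IH] //=; exact: smooth_inner_diff. Qed.

Lemma enorm_line x xi (t : R) : tangent_sphere (x, xi) -> `|t| <= enorm (x + t *: xi).
Proof.
move=> [/= /enorm1_dotr xi1 xxi]; rewrite -sqrtr_sqr ler_sqrt; last exact: dotr_sqr_ge0.
rewrite dotr_sqrD [dotr x (t *: xi)]dotrC !dotrZl [dotr xi (t *: xi)]dotrC dotrZl xi1.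
rewrite [dotr xi x]dotrC xxi !mulr0 addr0 mulr1 -expr2 lerDr.
exact: dotr_sqr_ge0.
Qed.

(** The filter [F] stands for either end of the line. As [x] is orthogonal to [xi], the point of
    parameter [t] has Euclidean norm at least [|t|]. *)
Lemma vanishes_line m (u : tensor_field R n m) x xi (F : set_system R) (FF : Filter F) :
  tangent_sphere (x, xi) -> vanishes_at_infty u ->
  (forall M : R, \forall t \near F, M < `|t|) ->
  contract u xi (x + t *: xi) @[t --> F] --> (0 : R).
Proof.
move=> xxi vu FM.
have lim : (x + t *: xi) @[t --> F] --> (@at_infty R n).
  move=> A [M _ MA]; have := FM M; apply: filterS => t Mt; apply: MA => /=.
  exact: lt_le_trans (enorm_line t xxi).
rewrite /contract; elim: (index_enum _) => [|i r IH].
  by under eq_fun do rewrite big_nil; exact: cvg_cst.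
have h : u i (x + t *: xi) * monomial xi i @[t --> F] --> (0 : R).
  rewrite -(mul0r (monomial xi i)); apply: cvgM; last exact: cvg_cst.
  exact: (cvg_comp _ _ lim (vu i)).
under eq_fun do rewrite big_cons.
by have := cvgD h IH; rewrite addr0; exact.
Qed.

(** By [contract_inner_diff], the contraction of each iterate, restricted to a line, has that of the
    next iterate as derivative; [rapid1_moments] then applies, the last one being Schwartz. *)
Lemma exact_moment_kernel k p (v : tensor_field R n p) :
  (forall i, smooth (v i)) ->
  (forall l, (l <= k)%N -> vanishes_at_infty (inner_diff_iter l v)) ->
  (forall i, schwartz (inner_diff_iter k.+1 v i)) ->
  in_moment_kernel k (inner_diff_iter k.+1 v).
Proof.
move=> sv vv sf q qk [x xi] xxi; rewrite moment_transformE/=.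
have xi0 : xi != 0 by case: xxi => /= /enorm1_neq0.
pose g l (t : R) := contract (inner_diff_iter l v) xi (x + t *: xi).
apply: (@rapid1_moments R k g) => //.
- by apply: rapid1_line => //; exact: schwartz_contract.
- move=> l lk t; have svl := @smooth_inner_diff_iter l p v sv.
  rewrite /g /= (contract_inner_diff xi _ svl).
  by apply: smooth_line; exact: smooth_contract.
- move=> l lk; apply: vanishes_line => //; first exact: vv.
  move=> M; near=> t; rewrite (lt_le_trans _ (ler_norm _))//.
  by near: t; apply: nbhs_pinfty_gt; exact: num_real.
- move=> l lk; apply: vanishes_line => //; first exact: vv.
  move=> M; near=> t; rewrite -normrN (lt_le_trans _ (ler_norm _))// ltrNr.
  by near: t; apply: nbhs_ninfty_lt; exact: num_real.
Unshelve. all: by end_near. Qed.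

End moments.

Lemma cast_field_schwartz (R : realType) (n m m' : nat) (e : m = m')
    (u : tensor_field R n m) :
  (forall i, schwartz (cast_field e u i)) -> forall i, schwartz (u i).
Proof. by destruct e; rewrite cast_field_id. Qed.

(** Subtraction being truncated, the equation [e] can hold only when [k < m]; the case [k = m],
    where [0] is the only field, is the first alternative. *)
Theorem theorem4p3 (R : realType) (n m k : nat) (f : tensor_field R n m)
    (hk1 : (1 <= k)%N) (hk : (k <= minn m n.-1)%N) (hf : schwartz_sym f) :
  in_moment_kernel k f <->
  ((k = m /\ f = fun _ _ => 0%R) \/
   exists (e : (k.+1 + (m - k.+1))%N = m) (v : tensor_field R n (m - k.+1)%N),
     [/\ smooth_sym v,
         forall l : nat, (l <= k)%N -> vanishes_at_infty (inner_diff_iter l v)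
       & f = cast_field e (inner_diff_iter k.+1 v)]).
Proof.
have [km kn] : (k <= m)%N /\ (k <= n.-1)%N by apply/andP; rewrite -leq_min.
(* Two distinct axes exist, hence the planes of the Fourier argument. *)
have n1 : (1 < n)%N by rewrite -ltn_predRL; exact: leq_trans kn.
split=> [If|[[_ f0]|[e [v [[_ sv] vv fv]]]]].
- have l01 : Ordinal (ltnW n1) != Ordinal n1 by [].
  have [?|[p [e [v [[symv sv] fv]]]]] := moment_kernel_exact l01 km hf If; first by left.
  have ep : p = (m - k.+1)%N by rewrite -e addKn.
  subst p; right; exists e, v; split=> // [|l _ i].
    by split=> // i; exact: schwartz_smooth.
  exact/schwartz_vanishes/schwartz_inner_diff_iter.
- move=> q _ [x xi] _; rewrite moment_transformE f0 /=.
  transitivity (Iline (fun=> 0 : R)); last by rewrite /Iline Rintegral_cst// mul0r.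
  congr Iline; apply/funext => t.
  by rewrite /contract big1 ?mulr0// => i _; rewrite mul0r.
- case: hf => _; rewrite fv => /cast_field_schwartz sf q qk p pp.
  by rewrite moment_cast; exact: exact_moment_kernel.
Qed.
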